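(* Let $K$ be a field and let $I\subsetneq S=K[x_1,\ldots,x_n]$ be a polymatroidal ideal. Then $$\lim_{k\to\infty}\operatorname{depth} S/I^k=n-\ell(I).$$
   Context: A discrete polymatroid on $[n]=\{1,\ldots,n\}$ is a nonempty finite set $\mathcal P\subset \mathbb Z_{\ge 0}^n$ such that: (1) if $u\in\mathcal P$, $v\in\mathbb Z_{\ge0}^n$ and $v\le u$ componentwise, then $v\in\mathcal P$; (2) if $u,v\in\mathcal P$ with $|u|<|v|$ (where $|u|=\sum_i u(i)$), then there is $i$ with $u(i)<v(i)$ and $u+\varepsilon_i\in\mathcal P$, where $\varepsilon_i$ is the $i$th canonical basis vector. Its set of bases $B(\mathcal P)$ consists of the elements of $\mathcal P$ that are maximal with respect to $\le$; they all have the same modulus. Writing $x^u=\prod_i x_i^{u(i)}$, a polymatroidal ideal is a monomial ideal of $S$ whose set of minimal monomial generators is $\{x^u : u\in B(\mathcal P)\}$ for some discrete polymatroid $\mathcal P$ on $[n]$. Depth is with respect to $\mathfrak m=(x_1,\ldots,x_n)$. By Brodmann, $\operatorname{depth} S/I^k$ is constant for $k\gg0$, and the limit is this constant. The analytic spread $\ell(I)$ is the Krull dimension of the fiber ring $\mathcal R(I)/\mathfrak m\mathcal R(I)$, where $\mathcal R(I)=\bigoplus_{k\ge0}I^kt^k$ is the Rees algebra of $I$. *)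

(* Defs.v *)
From HB Require Import structures.
From mathcomp Require Import all_boot all_order all_algebra.
From mathcomp Require Import finmap.
From mathcomp Require Import boolp.
From mathcomp.multinomials Require Import mpoly.

Set Implicit Arguments.
Unset Strict Implicit.
Unset Printing Implicit Defensive.

Import GRing.Theory.
Local Open Scope ring_scope.
Local Open Scope quotient_scope.

(* The library only has proper ideals ([idealr]); here R itself is an ideal. *)
HB.mixin Record isMullClosed (R : comNzRingType) (J : R -> bool) := {
  mem_mull : forall a, {in J, forall x, a * x \in J}
}.

#[short(type="ideal")]
HB.structure Definition Ideal (R : comNzRingType) :=
  {J of GRing.ZmodClosed R J & isMullClosed R J}.

Section IdealSpan.
Variables (R : comNzRingType) (G : R -> Prop).

Definition ideal_span : {pred R} := fun x =>
  `[< exists2 s : seq (R * R), forall p, p \in s -> G p.2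
      & x = \sum_(p <- s) p.1 * p.2 >].

Lemma ideal_span_mull a : {in ideal_span, forall x, a * x \in ideal_span}.
Proof.
move=> x /asboolP[s Gs ->]; apply/asboolP.
exists [seq (a * p.1, p.2) | p <- s] => [p /mapP[q /Gs Gq ->] //|].
by rewrite big_map mulr_sumr; apply: eq_bigr => p _; rewrite mulrA.
Qed.

Lemma ideal_span_zmod_closed : zmod_closed ideal_span.
Proof.
split=> [|x y xG]; first by apply/asboolP; exists [::] => //; rewrite big_nil.
rewrite -mulN1r => /(ideal_span_mull (-1)); move: xG.
move=> /asboolP[s Gs ->] /asboolP[t Gt ->]; apply/asboolP.
by exists (s ++ t) => [p|]; [rewrite mem_cat => /orP[/Gs|/Gt] | rewrite big_cat].
Qed.

HB.instance Definition _ :=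
  GRing.isZmodClosed.Build R ideal_span ideal_span_zmod_closed.
HB.instance Definition _ := isMullClosed.Build R ideal_span ideal_span_mull.

Lemma mem_ideal_span x : G x -> x \in ideal_span.
Proof.
move=> Gx; apply/asboolP; exists [:: (1, x)]; last by rewrite big_seq1 mul1r.
by move=> p; rewrite inE => /eqP->.
Qed.

End IdealSpan.

Section IdealPower.
Variables (R : comNzRingType) (I : {pred R}).

(* For k = 0 the only generator is the empty product, so that I^0 = R. *)
Definition ideal_exp (k : nat) : {pred R} :=
  ideal_span (fun x => exists2 t : k.-tuple R,
    {subset t <= I} & x = \prod_(y <- t) y).

HB.instance Definition _ k := Ideal.copy (ideal_exp k)
  (ideal_span (fun x => exists2 t : k.-tuple R,
    {subset t <= I} & x = \prod_(y <- t) y)).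

Lemma ideal_expM j k x y :
  x \in ideal_exp j -> y \in ideal_exp k -> x * y \in ideal_exp (j + k).
Proof.
move=> /asboolP[s Hs ->] /asboolP[t Ht ->]; rewrite mulr_suml big_seq.
apply: rpred_sum => p ps; rewrite mulr_sumr big_seq.
apply: rpred_sum => q qt; rewrite mulrACA; apply: mem_mull.
apply: mem_ideal_span.
have [u uI ->] := Hs _ ps; have [v vI ->] := Ht _ qt.
exists (cat_tuple u v); last by rewrite big_cat.
by move=> z; rewrite mem_cat => /orP[/uI|/vI].
Qed.

Lemma ideal_exp0 x : x \in ideal_exp 0.
Proof.
rewrite -[x]mulr1; apply: mem_mull; apply: mem_ideal_span.
by exists [tuple] => //; rewrite big_nil.
Qed.

End IdealPower.

Section QuotientModule.
Variables (R : comNzRingType) (J : ideal R).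
Local Notation Q := {ideal_quot J}.

Definition quot_scale (a : R) (x : Q) : Q := \pi_Q (a * repr x).

Lemma pi_scale a v : quot_scale a (\pi_Q v) = \pi_Q (a * v).
Proof.
apply/eqP; rewrite /quot_scale -Quotient.idealrBE -mulrBr mem_mull //.
by rewrite Quotient.idealrBE reprK.
Qed.

Lemma quot_scaleA a b x : quot_scale a (quot_scale b x) = quot_scale (a * b) x.
Proof. by rewrite -[x]reprK (pi_scale b) !pi_scale mulrA. Qed.

Lemma quot_scale1 : left_id 1 quot_scale.
Proof. by move=> x; rewrite -[x]reprK pi_scale mul1r. Qed.

Lemma quot_scaleDr : right_distributive quot_scale +%R.
Proof.
move=> a x y; rewrite -[x]reprK -[y]reprK -raddfD !pi_scale.
by rewrite -raddfD mulrDr.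
Qed.

Lemma quot_scaleDl x : {morph quot_scale^~ x : a b / a + b}.
Proof. by move=> a b; rewrite -[x]reprK !pi_scale mulrDl raddfD. Qed.

HB.instance Definition _ := GRing.Zmodule_isLmodule.Build R Q
  quot_scaleA quot_scale1 quot_scaleDr quot_scaleDl.

End QuotientModule.

Section Depth.
Variables (R : comNzRingType) (M : lmodType R).

Definition in_smul (s : seq R) (v : M) :=
  exists w : nat -> M, v = \sum_(i < size s) s`_i *: w i.

(* The second conjunct says that s`_i is not a zero divisor on
   M / (s_0, ..., s_(i-1)) M. *)
Definition regular_sequence (s : seq R) :=
  (exists v : M, ~ in_smul s v) /\
  (forall i, (i < size s)%N -> forall v : M,
     in_smul (take i s) (s`_i *: v) -> in_smul (take i s) v).

Definition is_depth (m : {pred R}) (d : nat) :=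
  (exists s, [/\ {subset s <= m}, regular_sequence s & size s = d]) /\
  (forall s, {subset s <= m} -> regular_sequence s -> (size s <= d)%N).

End Depth.

Arguments is_depth {R} M m d.

Section KrullDimension.
Variable A : comNzRingType.

Definition prime_ideal (p : {pred A}) := idealr_closed p /\ prime_idealr_closed p.

Definition prime_chain (d : nat) (p : 'I_d.+1 -> {pred A}) :=
  (forall i, prime_ideal (p i)) /\
  (forall i j : 'I_d.+1, (i < j)%N ->
     {subset p i <= p j} /\ exists2 x, x \in p j & x \notin p i).

Definition is_krull_dim (d : nat) :=
  (exists p : 'I_d.+1 -> {pred A}, prime_chain p) /\
  (forall e (p : 'I_e.+1 -> {pred A}), prime_chain p -> (e <= d)%N).

End KrullDimension.

Section ReesAlgebra.
Variables (R : comNzRingType) (I : {pred R}).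

Definition rees_pred : {pred {poly R}} := fun f =>
  `[< forall k, f`_k \in ideal_exp I k >].

Lemma rees_subring_closed : subring_closed rees_pred.
Proof.
split.
- apply/asboolP => k; rewrite coef1; case: k => [|k]; first exact: ideal_exp0.
  exact: rpred0.
- move=> f g /asboolP fI /asboolP gI; apply/asboolP => k; rewrite coefB.
  by rewrite rpredB.
- move=> f g /asboolP fI /asboolP gI; apply/asboolP => k; rewrite coefM.
  apply: rpred_sum => i _.
  by have := ideal_expM (fI i) (gI (k - i)%N); rewrite subnKC ?leq_ord.
Qed.

HB.instance Definition _ :=
  GRing.isSubringClosed.Build {poly R} rees_pred rees_subring_closed.

Record rees := Rees { rees_val : {poly R}; rees_valP : rees_val \in rees_pred }.

HB.instance Definition _ := [isSub for rees_val].
HB.instance Definition _ := [Choice of rees by <:].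
HB.instance Definition _ := [SubChoice_isSubComNzRing of rees by <:].

End ReesAlgebra.

Section PolynomialRing.
Variables (K : fieldType) (n : nat).
Local Notation S := {mpoly K[n]}.

Definition irrelevant_ideal : {pred S} :=
  ideal_span (fun f : S => exists i : 'I_n, f = 'X_i).

HB.instance Definition _ := Ideal.copy irrelevant_ideal
  (ideal_span (fun f : S => exists i : 'I_n, f = 'X_i)).

Lemma irrelevant_ideal_mcoeff0 f : f \in irrelevant_ideal -> f@_0%MM = 0.
Proof.
move=> /asboolP[s Hs ->]; rewrite raddf_sum /= big_seq big1 // => p /Hs[i ->].
rewrite -[_@_0%MM]/(mcoeff 0%MM _) rmorphM /= mcoeffX.
by rewrite mnm1_eq0 mulr0.
Qed.

Variable I : {pred S}.

(* The extension m R(I) of the irrelevant ideal m to the Rees algebra. *)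
Definition rees_irrelevant : {pred rees I} :=
  ideal_span (fun a : rees I =>
    exists2 f : S, f \in irrelevant_ideal & rees_val a = f%:P).

Lemma rees_irrelevant_idealr_closed : idealr_closed rees_irrelevant.
Proof.
split; first exact: (ideal_span_zmod_closed _).1; last first.
  move=> a x y xG yG; apply: (@rpredD _ (ideal_span _)) yG.
  exact: ideal_span_mull.
apply/negP => /asboolP[s Hs] /(congr1 (@rees_val _ _)).
rewrite -![rees_val _]/(val _) rmorph1 rmorph_sum /=.
move=> /(congr1 (fun f : {poly S} => mcoeff 0%MM f`_0)) /eqP.
rewrite coef1 eqxx mcoeff1 eqxx coef_sum raddf_sum big_seq big1 ?oner_eq0 //=.
move=> p /Hs[f /irrelevant_ideal_mcoeff0 f0 p2].
rewrite -[X in X`_0]/(polyseq (rees_val p.1 * rees_val p.2)) p2.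
by rewrite coefMC rmorphM /= f0 mulr0.
Qed.

HB.instance Definition _ :=
  isIdealr.Build (rees I) rees_irrelevant rees_irrelevant_idealr_closed.

Definition fiber_ring : comNzRingType := {ideal_quot rees_irrelevant}.

Definition is_analytic_spread (l : nat) := is_krull_dim fiber_ring l.

End PolynomialRing.

Section Polymatroids.
Variables (K : fieldType) (n : nat).

Definition discrete_polymatroid (P : {fset 'X_{1..n}}) :=
  [/\ P != fset0,
      (forall u v : 'X_{1..n}, u \in P -> (v <= u)%MM -> v \in P)
    & (forall u v : 'X_{1..n}, u \in P -> v \in P -> (mdeg u < mdeg v)%N ->
         exists2 i : 'I_n, (u i < v i)%N & (u + U_(i))%MM \in P)].

Definition polymatroid_base (P : {fset 'X_{1..n}}) (u : 'X_{1..n}) :=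
  u \in P /\ forall v, v \in P -> (u <= v)%MM -> v = u.

Definition monomial_ideal (U : 'X_{1..n} -> Prop) : {pred {mpoly K[n]}} :=
  ideal_span (fun f : {mpoly K[n]} => exists2 u, U u & f = 'X_[u]).

Definition minimal_monomial_generators (I : {pred {mpoly K[n]}})
    (U : 'X_{1..n} -> Prop) :=
  I =i monomial_ideal U /\
  forall V : 'X_{1..n} -> Prop, (forall u, V u -> U u) ->
    I =i monomial_ideal V -> forall u, U u -> V u.

Definition polymatroidal_ideal (I : {pred {mpoly K[n]}}) :=
  exists2 P : {fset 'X_{1..n}}, discrete_polymatroid P
    & minimal_monomial_generators I (polymatroid_base P).

End Polymatroids.

(* Main.v *)
From HB Require Import structures.
Require Import Defs.
From mathcomp Require Import all_boot all_order all_algebra.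
From mathcomp Require Import finmap boolp ring zify.
From mathcomp.multinomials Require Import mpoly.

(* Let B be the set of bases and kB the set of sums of k bases, so that I^k is
   generated by the monomials x^u with u in kB. Call i and j linked if
   u + e_i = v + e_j for some k and u, v in kB. This is an equivalence relation,
   with c classes say, and kB is the product of its projections to the classes:
   l(I) = n - c + 1 and depth S/I^k = c - 1 for k large.

   The fiber ring is the monomial algebra K[x^u t : u in B]. Identifying
   successively the variables of each class and finally sending all variables
   to 0 produces a chain of n - c + 1 prime kernels above 0; conversely an
   element of kB is determined by n - c + 1 of its coordinates, so by counting
   monomials any n - c + 2 elements of the fiber ring are algebraically
   dependent, which bounds the length of chains of primes.

   For the depth, choose one variable y_0, ..., y_(c-1) in each class. The
   differences y_0 - y_a form a regular sequence on S/I^k for every k, because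
   modulo the first ones I^k becomes the intersection of a monomial ideal that
   does not involve y_a and one that does not involve y_0. For k large some u in
   kB remains in kB when y_(class of i) is replaced by x_i, for each i, and then
   x^u / y_0 is a socle element modulo these differences. Finally a regular
   sequence whose quotient has a nonzero socle is of maximal length, by the
   usual comparison of Koszul cohomology. *)

Set Implicit Arguments.
Unset Strict Implicit.
Unset Printing Implicit Defensive.

Import GRing.Theory.
Local Open Scope ring_scope.

(** * Depth and Koszul cochains *)

Section InSmul.
Variables (R : comNzRingType) (M : lmodType R).
Implicit Types (s : seq R) (v w : M).

Lemma in_smul0 s : in_smul s (0 : M).
Proof. by exists (fun=> 0); rewrite big1 // => i _; rewrite scaler0. Qed.

Lemma in_smulD s v w : in_smul s v -> in_smul s w -> in_smul s (v + w).
Proof.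
move=> [f ->] [g ->]; exists (fun i => f i + g i).
by rewrite -big_split; apply: eq_bigr => i _; rewrite scalerDr.
Qed.

Lemma in_smulZ s a v : in_smul s v -> in_smul s (a *: v).
Proof.
move=> [f ->]; exists (fun i => a *: f i).
by rewrite scaler_sumr; apply: eq_bigr => i _; rewrite !scalerA mulrC.
Qed.

Lemma in_smul_sum (T : Type) (r : seq T) (P : pred T) s (f : T -> M) :
  (forall i, P i -> in_smul s (f i)) -> in_smul s (\sum_(i <- r | P i) f i).
Proof.
by move=> sf; apply: big_ind sf; [apply: in_smul0 | apply: in_smulD].
Qed.

(** This stands in for quotient modules: a membership modulo one more element of the sequence is a
    membership modulo the previous ones, up to a multiple of the new element. *)
Lemma in_smul_take s i v : (i < size s)%N ->
  in_smul (take i.+1 s) v <-> exists w, in_smul (take i s) (v - s`_i *: w).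
Proof.
move=> lt_is; have st : size (take i s) = i by rewrite size_takel // ltnW.
have stS : size (take i.+1 s) = i.+1 by rewrite size_takel.
split=> [[f]|[w [f]]].
  rewrite stS big_ord_recr /= nth_take // => ->; exists (f i).
  rewrite addrK; exists f; rewrite st; apply: eq_bigr => j _.
  by rewrite !nth_take ?ltnS ?(ltnW (ltn_ord j)).
rewrite st => /eqP; rewrite subr_eq => /eqP->.
exists (fun j => if j == i then w else f j).
rewrite stS big_ord_recr /= eqxx nth_take //; congr (_ + _).
apply: eq_bigr => j _.
by rewrite (ltn_eqF (ltn_ord j)) !nth_take ?ltnS ?(ltnW (ltn_ord j)).
Qed.

End InSmul.

Section Koszul.
Variables (R : comNzRingType) (M : lmodType R) (n : nat) (x : 'I_n -> R).
Local Notation cochain := ({set 'I_n} -> M).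
Implicit Types (f g : cochain) (A : {set 'I_n}) (i j : 'I_n).

(** The sign of moving [e_i] past the smaller elements of [A]. A cochain lists the coefficients of
    all [e_A]; its part of degree j is its restriction to the sets with j elements. *)
Definition koszul_sign i A : R := (-1) ^+ #|[set j in A | (j < i)%N]|.

(** Exterior multiplication by the sum of the [x i] times [e_i]; [koszul_contract i] is the interior
    product with the dual of [e_i]. *)
Definition koszul_diff f : cochain := fun A =>
  \sum_(i in A) (koszul_sign i A * x i) *: f (A :\ i).

Definition koszul_contract i f : cochain := fun A =>
  if i \in A then 0 else koszul_sign i A *: f (i |: A).

Lemma koszul_signK i A : koszul_sign i A * koszul_sign i A = 1.
Proof. by rewrite /koszul_sign -expr2 sqrr_sign. Qed.

Lemma koszul_signU1 i j A : j \notin A ->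
  koszul_sign i (j |: A) = (-1) ^+ (j < i)%N * koszul_sign i A.
Proof.
move=> jA; rewrite /koszul_sign; case: ltnP => lji.
  have -> : [set k in j |: A | (k < i)%N] = j |: [set k in A | (k < i)%N].
    by apply/setP => k; rewrite !inE; case: eqP => // ->; rewrite lji.
  by rewrite cardsU1 inE (negPf jA) exprD.
rewrite mul1r; congr (_ ^+ #|pred_of_set _|); apply/setP => k; rewrite !inE.
by case: eqP => // ->; rewrite (negPf jA) ltnNge lji.
Qed.

(** The terms with [j != i] cancel: exactly one of [j < i] and [i < j] holds, so exactly one of the
    two sign comparisons contributes -1. *)
Lemma koszul_homotopy i f A :
  koszul_diff (koszul_contract i f) A + koszul_contract i (koszul_diff f) A
    = x i *: f A.
Proof.
rewrite /koszul_diff /koszul_contract; case: ifPn => iA.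
  rewrite addr0 (bigD1 i) //= big1 ?addr0 => [|j /andP[jA ji]]; last first.
    by rewrite in_setD1 eq_sym ji iA scaler0.
  rewrite setD11 setD1K // scalerA.
  have -> : koszul_sign i A = koszul_sign i (A :\ i).
    by rewrite -{1}(setD1K iA) koszul_signU1 ?setD11 // ltnn mul1r.
  by rewrite mulrAC koszul_signK mul1r.
rewrite scaler_sumr big_setU1 //= setU1K // addrCA -big_split /= scalerA.
rewrite mulrA koszul_signU1 // ltnn mul1r koszul_signK mul1r.
rewrite big1 ?addr0 // => j jA.
have ji : j != i by apply: contraNneq iA => <-.
rewrite in_setD1 (negPf iA) andbF !scalerA.
have -> : (i |: A) :\ j = i |: (A :\ j).
  rewrite setDUl; congr (_ :|: _).
  by apply/setDidPl; rewrite disjoints1 inE eq_sym.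
rewrite -scalerDl koszul_signU1 //.
have -> : koszul_sign i A = (-1) ^+ (j < i)%N * koszul_sign i (A :\ j).
  by rewrite -koszul_signU1 ?setD11 // setD1K.
rewrite [X in X *: _](_ : _ = 0) ?scale0r //.
case: ltngtP => [_|_|/val_inj/eqP]; last by rewrite (negPf ji).
  by rewrite expr1 expr0; ring.
by rewrite expr1 expr0; ring.
Qed.

Lemma koszul_diffB f g A :
  koszul_diff (fun B => f B - g B) A = koszul_diff f A - koszul_diff g A.
Proof. by rewrite -sumrB; apply: eq_bigr => i _; rewrite scalerBr. Qed.

Lemma koszul_diffZ a f A :
  koszul_diff (fun B => a *: f B) A = a *: koszul_diff f A.
Proof.
by rewrite scaler_sumr; apply: eq_bigr => i _; rewrite !scalerA mulrC.
Qed.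

Lemma koszul_diff_sum (c : 'I_n -> R) (F : 'I_n -> cochain) A :
  koszul_diff (fun B => \sum_i c i *: F i B) A =
    \sum_i c i *: koszul_diff (F i) A.
Proof.
rewrite /koszul_diff; under eq_bigr do rewrite scaler_sumr.
rewrite exchange_big; apply: eq_bigr => i _; rewrite scaler_sumr.
by apply: eq_bigr => j _; rewrite !scalerA mulrC.
Qed.

Lemma in_smul_koszul_diff s f A :
  (forall i, i \in A -> in_smul s (f (A :\ i))) -> in_smul s (koszul_diff f A).
Proof. by move=> sf; apply: in_smul_sum => i iA; apply/in_smulZ/sf. Qed.

(* The contractions are homotopies from 0 to x_i, so they commute with d^2;
   since they recover f from its values on smaller sets, d^2 vanishes. *)
Lemma koszul_diffK f A : koszul_diff (koszul_diff f) A = 0.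
Proof.
have [m] := ubnP #|A|; elim: m => // m IHm in f A * => ltAm.
have [->|[i iA]] := set_0Vmem A; first by rewrite /koszul_diff big_set0.
have eqdd g B : koszul_contract i (koszul_diff g) B =
    x i *: g B - koszul_diff (koszul_contract i g) B.
  by rewrite -koszul_homotopy addrC addKr.
suff: koszul_contract i (koszul_diff (koszul_diff f)) (A :\ i) = 0.
  rewrite /koszul_contract setD11 setD1K // => /(congr1 (fun v =>
    koszul_sign i (A :\ i) *: v)).
  by rewrite scalerA koszul_signK scale1r scaler0.
have eqf : koszul_contract i (koszul_diff f) =
    (fun B => x i *: f B - koszul_diff (koszul_contract i f) B).
  by apply/funext => B.
rewrite eqdd eqf koszul_diffB koszul_diffZ IHm ?subr0 ?subrr //.
by rewrite -ltnS (leq_trans _ ltAm) // ltnS [X in (_ < X)%N](cardsD1 i) iA.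
Qed.

Definition koszul_contract_sum (c : 'I_n -> R) f : cochain := fun A =>
  \sum_i c i *: koszul_contract i f A.

Lemma koszul_homotopy_sum c f A :
  koszul_diff (koszul_contract_sum c f) A +
    koszul_contract_sum c (koszul_diff f) A = (\sum_i c i * x i) *: f A.
Proof.
rewrite koszul_diff_sum -big_split /= scaler_suml; apply: eq_bigr => i _.
by rewrite -scalerDr koszul_homotopy scalerA.
Qed.

Lemma in_smul_koszul_contract s c f A :
  (forall i, i \notin A -> in_smul s (f (i |: A))) ->
  in_smul s (koszul_contract_sum c f A).
Proof.
move=> sf; apply: in_smul_sum => i _; apply: in_smulZ.
rewrite /koszul_contract; case: ifPn => [_|/sf sfi]; first exact: in_smul0.
exact: in_smulZ.
Qed.

(** Vanishing of the j-th Koszul cohomology of [M / sM], with cochains and congruences lifted to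
    [M]. *)
Definition koszul_exact s (j : nat) := forall f,
  (forall A, #|A| = j.+1 -> in_smul s (koszul_diff f A)) ->
  exists g, forall A, #|A| = j -> in_smul s (f A - koszul_diff g A).

Lemma card_setD1 (j : nat) i A : i \in A -> #|A| = j.+1 -> #|A :\ i| = j.
Proof. by move=> iA; rewrite (cardsD1 i) iA => -[]. Qed.

(** Let b be the next element of [s]. For a cocycle f the homotopy gives b f = d h, so h is a
    cocycle modulo one more element; by induction h = d u + b y, whence b f = b d y, and b cancels.
    In degree 0 a cocycle is killed by all [x k], hence by b. *)
Lemma koszul_exact_take s (i j : nat) :
  (forall b, b \in s -> exists c : 'I_n -> R, b = \sum_k c k * x k) ->
  regular_sequence M s -> (i + j < size s)%N -> koszul_exact (take i s) j.
Proof.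
move=> sx [_ sreg]; elim: j i => [|j IHj] i lt_ij f fP.
  have lt_i : (i < size s)%N by rewrite addn0 in lt_ij.
  have [c bE] := sx _ (mem_nth 0 lt_i).
  exists (fun=> 0) => A /eqP; rewrite cards_eq0 => /eqP ->.
  rewrite {1}/koszul_diff big_set0 subr0; apply: sreg => //.
  rewrite bE -koszul_homotopy_sum {1}/koszul_diff big_set0 add0r.
  apply: in_smul_koszul_contract => k _; apply: fP.
  by rewrite cardsU1 inE cards0.
have lt_i : (i < size s)%N by rewrite (leq_ltn_trans _ lt_ij) // leq_addr.
have [c bE] := sx _ (mem_nth 0 lt_i).
set b := s`_i in bE; set h := koszul_contract_sum c f.
have dh A : #|A| = j.+1 -> in_smul (take i s) (b *: f A - koszul_diff h A).
  move=> cA; rewrite bE -koszul_homotopy_sum addrC addKr.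
  by apply: in_smul_koszul_contract => k kA; apply: fP; rewrite cardsU1 kA cA.
have [||u uP] := IHj i.+1 _ h; first by rewrite addSnnS.
  move=> A cA; apply/in_smul_take => //; exists (f A).
  by rewrite -opprB -scaleN1r; apply/in_smulZ/dh.
(* Only the values of [y] on sets with [j] elements matter below; elsewhere it is set to 0. *)
have /choice[y yP] A : exists w, #|A| = j ->
    in_smul (take i s) (h A - koszul_diff u A - b *: w).
  have [cA|] := pselect (#|A| = j); last by exists 0.
  by have /in_smul_take[//|w ?] := uP _ cA; exists w.
exists y => A cA; apply: sreg => //.
have: in_smul (take i s)
    (koszul_diff (fun B => h B - koszul_diff u B - b *: y B) A).
  by apply: in_smul_koszul_diff => k kA; apply: yP; apply: card_setD1 cA.
rewrite !koszul_diffB koszul_diffK koszul_diffZ subr0.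
move=> /(in_smulD (dh A cA)); rewrite addrA subrK.
by rewrite -scalerBr.
Qed.

(** The long exact sequence of multiplication by the next element a of [s], by hand: d f = a y makes
    y a cocycle, since a cancels; then y = d u, and f - a u is a cocycle modulo one element less,
    hence some d v. *)
Lemma koszul_exact_regular s (i j : nat) :
  regular_sequence M s -> (i <= size s)%N ->
  (forall k, (k <= i + j)%N -> koszul_exact [::] k) ->
  koszul_exact (take i s) j.
Proof.
move=> [_ sreg]; elim: i j => [|i IHi] j lt_i ex0 f fP.
  by rewrite take0 in fP *; apply: ex0.
have /choice[y yP] A : exists w, #|A| = j.+1 ->
    in_smul (take i s) (koszul_diff f A - s`_i *: w).
  have [cA|] := pselect (#|A| = j.+1); last by exists 0.
  by have /in_smul_take[//|w ?] := fP _ cA; exists w.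
have [|||u uP] := IHi j.+1 _ _ y.
- exact: ltnW.
- by move=> k; rewrite addnS -addSn; apply: ex0.
- move=> A cA; apply: sreg => //.
  have: in_smul (take i s)
      (koszul_diff (fun B => koszul_diff f B - s`_i *: y B) A).
    by apply: in_smul_koszul_diff => k kA; apply: yP; apply: card_setD1 cA.
  rewrite koszul_diffB koszul_diffK koszul_diffZ sub0r.
  by move=> /(in_smulZ (-1)); rewrite scaleN1r opprK.
have [|||v vP] := IHi j _ _ (fun A => f A - s`_i *: u A).
- exact: ltnW.
- by move=> k le_k; apply: ex0; rewrite addSn ltnW.
- move=> A cA; rewrite koszul_diffB koszul_diffZ.
  have := in_smulD (yP A cA) (in_smulZ s`_i (uP A cA)).
  by rewrite scalerBr addrA subrK.
exists v => A cA; apply/in_smul_take => //; exists (u A).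
by rewrite addrAC; apply: vP.
Qed.

End Koszul.

(** A longer regular sequence in [m] would make the Koszul cohomology of [M] vanish up to degree
    [size s], hence that of [M / sM] in degree 0, where [v] gives a nonzero class. *)
Lemma is_depth_socle (R : comNzRingType) (M : lmodType R) (n : nat)
    (x : 'I_n -> R) (m : {pred R}) (s : seq R) (v : M) :
  (forall b, b \in m -> exists c : 'I_n -> R, b = \sum_i c i * x i) ->
  {subset s <= m} -> regular_sequence M s -> ~ in_smul s v ->
  (forall i, in_smul s (x i *: v)) -> is_depth M m (size s).
Proof.
move=> mx sm sreg sv sxv; split=> [|t tm treg]; first by exists s.
rewrite leqNgt; apply/negP => lt_st; apply: sv.
have tx b : b \in t -> exists c : 'I_n -> R, b = \sum_i c i * x i.
  by move=> /tm /mx.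
have ex0 k : (k <= size s)%N -> koszul_exact M x [::] k.
  move=> le_k; rewrite -(take0 t).
  by apply: koszul_exact_take => //; apply: leq_trans lt_st.
have [|A|g gP] := koszul_exact_regular (i := size s) (j := 0) (x := x) sreg
  (leqnn _) _ (f := fun=> v).
- by move=> k; rewrite addn0; apply: ex0.
- rewrite take_size => _; apply: in_smul_sum => i _.
  by rewrite -scalerA; apply: in_smulZ.
have := gP set0 (cards0 _).
by rewrite take_size /koszul_diff big_set0 subr0.
Qed.

(** * Sums of bases of a polymatroid *)

Section Bases.
Variables (n : nat) (B : 'X_{1..n} -> Prop).
Implicit Types (u v w : 'X_{1..n}) (i j : 'I_n) (k l : nat) (A : {pred 'I_n}).

Definition base_exchange := forall u v i, B u -> B v -> (v i < u i)%N ->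
  exists2 j, (u j < v j)%N & B (u - U_(i) + U_(j))%MM.

Fixpoint msums k u : Prop :=
  if k is l.+1 then exists v w, [/\ B v, msums l w & u = (v + w)%MM]
  else u = 0%MM.

Lemma msums1 u : B u -> msums 1 u.
Proof. by move=> Bu; exists u, 0%MM; rewrite addm0. Qed.

Lemma msumsD k l u v : msums k u -> msums l v -> msums (k + l) (u + v)%MM.
Proof.
elim: k u => [|k IHk] u /=; first by move=> ->; rewrite add0m.
move=> [a [b [Ba kb ->]]] lv; exists a, (b + v)%MM.
split=> //; first exact: IHk.
by rewrite addmA.
Qed.

Lemma msums_sum (T : Type) (r : seq T) (P : pred T) (F : T -> nat)
    (G : T -> 'X_{1..n}) :
  (forall t, P t -> msums (F t) (G t)) ->
  msums (\sum_(t <- r | P t) F t)%N (\sum_(t <- r | P t) G t)%MM.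
Proof.
by move=> FG; apply: (big_rec2 msums) => // t k u /FG; apply: msumsD.
Qed.

Lemma msumsMn k u : B u -> msums k (u *+ k)%MM.
Proof.
move=> Bu; elim: k => [|k IHk]; first by rewrite mulm0n.
by rewrite mulmS; exists u, (u *+ k)%MM.
Qed.

Lemma mdeg_msums d k u : (forall v, B v -> mdeg v = d) -> msums k u ->
  mdeg u = (k * d)%N.
Proof.
move=> Bd; elim: k u => [|k IHk] u /=; first by move=> ->; rewrite mdeg0.
by move=> [v [w [/Bd dv /IHk dw ->]]]; rewrite mdegD dv dw mulSn.
Qed.

Definition linked i j :=
  `[< exists k u v, [/\ msums k u, msums k v & (u + U_(i) = v + U_(j))%MM] >].

Lemma linked_refl : reflexive linked.
Proof. by move=> i; apply/asboolP; exists 0%N, 0%MM, 0%MM. Qed.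

Lemma linked_sym i j : linked i j = linked j i.
Proof.
by apply/idP/idP => /asboolP[k [u [v [ku kv uv]]]];
  apply/asboolP; exists k, v, u.
Qed.

Lemma linked_trans : transitive linked.
Proof.
move=> j i l /asboolP[k [u [v [ku kv uv]]]].
move=> /asboolP[k' [u' [v' [ku' kv' uv']]]].
apply/asboolP; exists (k + k')%N, (u + u')%MM, (v + v')%MM.
split; try exact: msumsD.
apply/mnmP => a; move/mnmP/(_ a): uv; move/mnmP/(_ a): uv'.
by rewrite !mnmDE; lia.
Qed.

Definition link_closed A := forall i j, linked i j -> (i \in A) = (j \in A).

Definition mnm_mix A u v := [multinom if i \in A then u i else v i | i < n].

(** An exchange moves a unit between linked indices only, so exchanging [u] towards [v] outside [A]
    never changes the coordinates in [A]. *)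
Lemma base_mix A u v : base_exchange -> link_closed A -> B u -> B v ->
  B (mnm_mix A u v).
Proof.
move=> BX clA; have linkB a i j : B a -> (0 < a i)%N ->
    B (a - U_(i) + U_(j))%MM -> linked i j.
  move=> Ba a_i Ba'; apply/asboolP; exists 1%N, (a - U_(i) + U_(j))%MM, a.
  split; try exact: msums1.
  apply/mnmP => l; rewrite !mnmDE mnmBE !mnm1E.
  by have [<-|_] := eqVneq i l; lia.
(* The truncated differences measure the excess of [u] over [v] outside [A]; each exchange lowers
   their sum. *)
have [m] := ubnP (\sum_(i | i \notin A) (u i - v i))%N.
elim: m => // m IHm in u v * => lt_m Bu Bv.
have [[i iA lt_i]|] := pselect (exists2 i, i \notin A & (v i < u i)%N).
  have [j lt_j Bu'] := BX u v i Bu Bv lt_i.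
  have jA : j \notin A by rewrite -(clA i) // (linkB u) ?(leq_ltn_trans _ lt_i).
  have ij : i != j by apply: contraTneq lt_j => <-; rewrite -leqNgt ltnW.
  rewrite (_ : mnm_mix A u v = mnm_mix A (u - U_(i) + U_(j))%MM v); last first.
    apply/mnmP => l; rewrite !mnmE.
    case: ifP => // lA; have [E|_] := eqVneq i l; first by rewrite E lA in iA.
    by have [E|_] := eqVneq j l; [rewrite E lA in jA | lia].
  rewrite ltnS in lt_m; apply: IHm => //; apply: leq_trans lt_m.
  rewrite (bigD1 i) //= [X in (_ < X)%N](bigD1 i) //=.
  rewrite -addSn leq_add //.
    by rewrite mnmDE mnmBE !mnm1E eqxx [j == i]eq_sym (negPf ij); lia.
  apply: leq_sum => l /andP[_ li]; rewrite mnmDE mnmBE !mnm1E.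
  by rewrite [i == l]eq_sym (negPf li); have [<-|_] := eqVneq j l; lia.
(* Now [u] is at most [v] outside [A]. If some coordinate were strictly smaller, an exchange from
   [v] towards [u] would find an index outside [A] where [u] exceeds [v]. *)
move=> /forall2NP uv; have [[i iA lt_i]|] :=
  pselect (exists2 i, i \notin A & (u i < v i)%N).
  have [j lt_j Bv'] := BX v u i Bv Bu lt_i.
  have jA : j \notin A by rewrite -(clA i) // (linkB v) ?(leq_ltn_trans _ lt_i).
  by case: (uv j); rewrite ?lt_j.
move=> /forall2NP vu; rewrite (_ : mnm_mix A u v = u) //.
apply/mnmP => i; rewrite mnmE; case: ifPn => // iA.
by case: (uv i) (vu i) => // /negP; rewrite -leqNgt => ? [//|/negP]; lia.
Qed.

Lemma msums_mix A k u v : base_exchange -> link_closed A ->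
  msums k u -> msums k v -> msums k (mnm_mix A u v).
Proof.
move=> BX clA; elim: k u v => [|k IHk] u v /=.
  by move=> -> ->; apply/mnmP => i; rewrite mnmE; case: ifP.
move=> [a [b [Ba kb ->]]] [a' [b' [Ba' kb' ->]]].
exists (mnm_mix A a a'), (mnm_mix A b b'); split; try exact: IHk.
  exact: base_mix.
by apply/mnmP => i; rewrite !mnmE; case: ifP.
Qed.

(** The mix of [u] and [v] along [A] is a sum of [k] bases, so it has the degree of [v]; the part
    outside [A] cancels. *)
Lemma msums_sumE A d k u v : base_exchange -> (forall w, B w -> mdeg w = d) ->
  link_closed A -> msums k u -> msums k v ->
  (\sum_(i in A) u i = \sum_(i in A) v i)%N.
Proof.
move=> BX Bd clA ku kv; have := mdeg_msums Bd (msums_mix BX clA ku kv).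
rewrite -(mdeg_msums Bd kv) !mdegE (bigID (mem A)) /=.
rewrite [X in _ = X](bigID (mem A)) /=.
under eq_bigr => i iA do rewrite mnmE iA.
under [X in (_ + X)%N]eq_bigr => i iA do rewrite mnmE (negPf iA).
exact: addIn.
Qed.

Definition link_rep i := odflt i [pick j | linked i j].

Lemma linked_rep i : linked i (link_rep i).
Proof. by rewrite /link_rep; case: pickP => //= _; apply: linked_refl. Qed.

Lemma eq_link_rep i j : (link_rep i == link_rep j) = linked i j.
Proof.
apply/eqP/idP => [eq_ij|lij].
  apply: linked_trans (linked_rep i) _.
  by rewrite eq_ij linked_sym linked_rep.
have eqP a : linked i a = linked j a.
  apply/idP/idP; last exact: linked_trans.
  by apply: linked_trans; rewrite linked_sym.
rewrite /link_rep (eq_pick eqP); case: pickP => // /(_ j).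
by rewrite linked_refl.
Qed.

Lemma link_rep_id i : link_rep (link_rep i) = link_rep i.
Proof. by apply/eqP; rewrite eq_link_rep linked_sym linked_rep. Qed.

Lemma link_rep_closed (A : {pred 'I_n}) :
  link_closed [pred i | link_rep i \in A].
Proof. by move=> i j; rewrite -eq_link_rep !inE => /eqP->. Qed.

(** All coordinates in the class of [i0] are prescribed, and their sum is a positive multiple of the
    number of summands; so [k = l]. Then the sum over every other class is known, which recovers the
    coordinate at its representative. *)
Lemma msums_determined d k l b i0 u v :
  base_exchange -> (forall w, B w -> mdeg w = d) ->
  B b -> (0 < b i0)%N -> msums k u -> msums l v ->
  (forall i, (link_rep i != i) || (i == link_rep i0) -> u i = v i) -> u = v.
Proof.
move=> BX Bd Bb b_i0 ku lv uv.
have cl j := @link_rep_closed (pred1 j).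
have sumE j m w : msums m w ->
    (\sum_(i | link_rep i == j) w i = m * \sum_(i | link_rep i == j) b i)%N.
  move=> mw.
  rewrite -[LHS]/(\sum_(i in [pred i | link_rep i \in pred1 j]) w i)%N.
  rewrite (msums_sumE BX Bd (cl j) mw (msumsMn m Bb)) big_distrr /=.
  by apply: eq_bigr => i _; rewrite mulmnE mulnC.
have eq_kl : k = l.
  have := sumE (link_rep i0) _ _ ku.
  rewrite (eq_bigr v) => [|i /eqP Ei]; last first.
    by apply: uv; rewrite Ei eq_sym orNb.
  rewrite (sumE _ _ _ lv) => /eqP; rewrite eqn_pmul2r => [/eqP//|].
  by rewrite (bigD1 i0) //= addn_gt0 b_i0.
apply/mnmP => i; have [ri|] := eqVneq (link_rep i) i; last first.
  by move=> ri; apply: uv; rewrite ri.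
have := sumE i _ _ ku; rewrite eq_kl -(sumE i _ _ lv).
rewrite (bigD1 i) ?ri //= [X in _ = X](bigD1 i) ?ri //= => /eqP.
rewrite [X in (u i + X)%N](eq_bigr v) ?eqn_add2r => [/eqP//|].
move=> j /andP[/eqP rj ji].
by apply: uv; rewrite rj eq_sym ji.
Qed.

(** Add up the left members of link witnesses for all [i]; exchanging the i-th one for its partner
    replaces [link_rep i] by [i]. Copies of [b] fill up to [k] summands. *)
Lemma exists_central_msum b i0 : B b -> (0 < b i0)%N ->
  exists k0, forall k, (k0 <= k)%N -> exists u,
    [/\ msums k u, (0 < u (link_rep i0))%N
      & forall i, exists2 v, msums k v & (u + U_(i) = v + U_(link_rep i))%MM].
Proof.
move=> Bb b_i0.
have /choice[F FP] i : exists t : nat * 'X_{1..n} * 'X_{1..n},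
    [/\ msums t.1.1 t.1.2, msums t.1.1 t.2
      & (t.1.2 + U_(i) = t.2 + U_(link_rep i))%MM].
  by have /asboolP[k [u [v ?]]] := linked_rep i; exists (k, u, v).
(* The successor leaves room for one copy of [b], which makes the coordinate at [i0] positive when
   [i0] is its own representative. *)
pose K := (\sum_i (F i).1.1)%N; exists K.+1 => k ltKk.
pose u := (\sum_i (F i).1.2 + b *+ (k - K))%MM.
have ku : msums k u.
  rewrite -(subnKC (ltnW ltKk)); apply: msumsD; last exact: msumsMn.
  by apply: msums_sum => i _; have [] := FP i.
have uP i : exists2 v, msums k v & (u + U_(i) = v + U_(link_rep i))%MM.
  exists ((F i).2 + \sum_(j | j != i) (F j).1.2 + b *+ (k - K))%MM.
    rewrite -{1}(subnKC (ltnW ltKk)); apply: msumsD; last exact: msumsMn.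
    rewrite /K (bigD1 i) //=; apply: msumsD; first by have [] := FP i.
    by apply: msums_sum => j _; have [] := FP j.
  rewrite /u (bigD1 i) //=; apply/mnmP => a; have [_ _ /mnmP/(_ a)] := FP i.
  by rewrite !mnmDE; lia.
exists u; split=> //.
have [Ei|ne_i] := eqVneq (link_rep i0) i0.
  rewrite Ei mnmDE addn_gt0 mulmnE muln_gt0 b_i0 subn_gt0 ltKk orbT //.
have [v _ /mnmP/(_ (link_rep i0))] := uP i0.
rewrite !mnmDE !mnm1E eqxx eq_sym (negPf ne_i) addn0 addn1 => ->; lia.
Qed.

End Bases.

(** * From discrete polymatroids to base exchange *)

Lemma polymatroid_bases (n : nat) (P : {fset 'X_{1..n}}) :
  discrete_polymatroid P ->
  exists d, [/\ exists b, polymatroid_base P b,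
    (forall u, polymatroid_base P u -> mdeg u = d)
    & base_exchange (polymatroid_base P)].
Proof.
move=> [/fset0Pn[p0 Pp0] Pdown Paug].
have baseE u v : polymatroid_base P u -> v \in P -> (mdeg v <= mdeg u)%N.
  move=> [Pu umax] Pv; rewrite leqNgt; apply/negP => lt_uv.
  have [i _ /umax/(_ (lem_addr _ _))/eqP] := Paug _ _ Pu Pv lt_uv.
  by rewrite -{2}[u]addm0 eqm_add2l mnm1_eq0.
have degE u v : polymatroid_base P u -> polymatroid_base P v -> mdeg u = mdeg v.
  move=> bu bv; apply/eqP.
  by rewrite eqn_leq (baseE v u bv bu.1) (baseE u v bu bv.1).
have maxE u v : polymatroid_base P u -> v \in P -> mdeg v = mdeg u ->
    polymatroid_base P v.
  move=> bu Pv dv; split=> // w Pw le_vw; have := baseE _ _ bu Pw.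
  rewrite -(submK le_vw) mdegD dv -[X in (_ <= X)%N]add0n leq_add2r leqn0.
  by rewrite mdeg_eq0 => /eqP->; rewrite add0m.
have [b bb] : exists b, polymatroid_base P b.
  pose Q d := `[< exists2 u, u \in P & mdeg u = d >].
  have exQ : exists d, Q d by exists (mdeg p0); apply/asboolP; exists p0.
  have ubQ d : Q d -> (d <= \max_(u <- P) mdeg u)%N.
    by move=> /asboolP[u Pu <-]; apply: leq_bigmax_seq.
  case: (ex_maxnP exQ ubQ) => d /asboolP[u Pu <-] dmax.
  exists u; split=> // v Pv le_uv.
  have /dmax : Q (mdeg v) by apply/asboolP; exists v.
  rewrite -{1}(submK le_uv) mdegD -[X in (_ <= X)%N]add0n leq_add2r leqn0.
  by rewrite mdeg_eq0 => /eqP E; rewrite -(submK le_uv) E add0m.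
exists (mdeg b); split; first by exists b.
  by move=> u bu; apply: degE.
move=> u v i bu bv lt_i; have [Pu _] := bu; have [Pv _] := bv.
have u_i : (U_(i) <= u)%MM by rewrite lep1mP -lt0n (leq_ltn_trans _ lt_i).
have du : mdeg u = (mdeg (u - U_(i))%MM).+1.
  by rewrite -{1}(submK u_i) mdegD mdeg1 addn1.
(* Augment [u - U_(i)], of degree one less, towards [v]. The index found is not [i], where
   [u - U_(i)] is still at least [v]; the result has full degree, so it is a base. *)
have [|j lt_j Pj] := Paug (u - U_(i))%MM v (Pdown _ _ Pu (lem_subr _ _)) Pv.
  by rewrite -(degE _ _ bu bv) du.
exists j.
  move: lt_j; rewrite mnmBE mnm1E.
  have [<-|_] := eqVneq i j; last by rewrite subn0.
  by rewrite ltnNge -ltnS subn1 prednK ?(leq_ltn_trans _ lt_i) // lt_i.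
by apply: maxE bu Pj _; rewrite mdegD mdeg1 addn1 -du.
Qed.

(** * Depth of the powers *)

Section InSpan.
Local Open Scope quotient_scope.
Variable R : comNzRingType.
Implicit Types (s : seq R) (f g : R).

Definition in_span s f := in_smul s (f : R^o).

Lemma in_span0 s : in_span s 0. Proof. exact: in_smul0. Qed.

Lemma in_spanD s f g : in_span s f -> in_span s g -> in_span s (f + g).
Proof. exact: in_smulD. Qed.

Lemma in_spanM s f g : in_span s g -> in_span s (f * g).
Proof. exact: in_smulZ. Qed.

Lemma in_span_nth s i : (i < size s)%N -> in_span s s`_i.
Proof.
move=> lt_i; exists (fun j => (j == i)%:R).
rewrite (bigD1 (Ordinal lt_i)) //= big1 ?addr0 => [|j]; last first.
  by rewrite -val_eqE /= => /negPf->; rewrite scaler0.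
by rewrite eqxx /GRing.scale /= mulr1.
Qed.

Lemma in_smul_quot (J : ideal R) s f :
  in_smul s (\pi_{ideal_quot J} f) <-> exists2 r, r \in J & in_span s (f - r).
Proof.
have piE (w : nat -> R) : \pi_{ideal_quot J} (\sum_(i < size s) s`_i * w i) =
    \sum_(i < size s) s`_i *: \pi_{ideal_quot J} (w i).
  by rewrite raddf_sum; apply: eq_bigr => i _; exact/esym/pi_scale.
split=> [[w fE]|[r rJ [w fE]]].
  exists (f - \sum_(i < size s) s`_i * repr (w i)); last first.
    by exists (fun i => repr (w i)); rewrite opprB addrC subrK.
  rewrite Quotient.idealrBE; apply/eqP; apply: (etrans fE); apply: esym.
  apply: (etrans (piE (fun i => repr (w i)))).
  by apply: eq_bigr => i _; rewrite reprK.
exists (fun i => \pi_{ideal_quot J} (w i)); apply: etrans (piE w).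
apply/eqP; rewrite -Quotient.idealrBE.
by move: fE; rewrite /GRing.scale /= => <-; rewrite opprB addrC subrK.
Qed.

Lemma is_depth_quot (J : ideal R) (n : nat) (x : 'I_n -> R) (m : {pred R}) s f :
  (forall g, g \in m -> exists c : 'I_n -> R, g = \sum_i c i * x i) ->
  {subset s <= m} ->
  (forall i g, (i < size s)%N ->
    in_smul (take i s) (\pi_{ideal_quot J} (s`_i * g)) ->
    in_smul (take i s) (\pi_{ideal_quot J} g)) ->
  ~ in_smul s (\pi_{ideal_quot J} f) ->
  (forall i, in_smul s (\pi_{ideal_quot J} (x i * f))) ->
  is_depth {ideal_quot J} m (size s).
Proof.
move=> mx sm sreg sf sxf.
have scale_pi a g : a *: (\pi_{ideal_quot J} g : {ideal_quot J}) =
    \pi_{ideal_quot J} (a * g) by exact: pi_scale.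
apply: (@is_depth_socle _ _ n x _ _ (\pi_{ideal_quot J} f)) => //.
- split=> [|i lt_i v]; first by exists (\pi_{ideal_quot J} f).
  by rewrite -[v]reprK scale_pi; apply: sreg.
- by move=> i; rewrite scale_pi.
Qed.

End InSpan.

(** * Monomial ideals and identification of variables *)

Section MonomialIdeals.
Variables (K : fieldType) (n : nat).
Local Notation S := {mpoly K[n]}.
Implicit Types (f : S) (U V : 'X_{1..n} -> Prop) (u m : 'X_{1..n}) (i j : 'I_n).

HB.instance Definition _ U := Ideal.copy (@monomial_ideal K n U)
  (ideal_span (fun f : S => exists2 u, U u & f = 'X_[u])).

Lemma monomial_idealP U f : f \in monomial_ideal U <->
  (forall m, m \in msupp f -> exists2 u, U u & (u <= m)%MM).
Proof.
split=> [/asboolP[s sU ->] m|fU].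
  move=> ms; apply: contrapT => nU; move: ms.
  rewrite mcoeff_msupp raddf_sum big_seq big1 ?eqxx //= => p /sU[u Uu ->].
  apply/eqP; apply: contraT; rewrite -mcoeff_msupp (perm_mem (msuppMX _ _)).
  move=> /mapP[m' _ mE]; case: nU; exists u => //.
  by rewrite mE lem_addr.
rewrite [f]mpolyE big_seq; apply: rpred_sum => m /fU[u Uu le_um].
rewrite -(submK le_um) mpolyXD scalerAl; apply: mem_mull.
by apply: mem_ideal_span; exists u.
Qed.

Lemma mem_monomial_idealX U u : U u -> 'X_[u] \in monomial_ideal (K := K) U.
Proof. by move=> Uu; apply: mem_ideal_span; exists u. Qed.

Lemma monomial_idealX_le U m : 'X_[m] \in monomial_ideal (K := K) U ->
  exists2 u, U u & (u <= m)%MM.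
Proof. by move/monomial_idealP; apply; rewrite msuppX mem_head. Qed.

Lemma monomial_idealM U V W f g :
  (forall u v, U u -> V v -> W (u + v)%MM) ->
  f \in monomial_ideal U -> g \in monomial_ideal V ->
  f * g \in monomial_ideal W.
Proof.
move=> UV /monomial_idealP fU /monomial_idealP gV; apply/monomial_idealP => m.
move=> /msuppM_le/allpairsP[[a b] /= [/fU[u Uu le_u] /gV[v Vv le_v] ->]].
exists (u + v)%MM; first exact: UV.
by apply/mnm_lepP => i; rewrite !mnmDE leq_add // (mnm_lepP _).
Qed.

Lemma ideal_exp_monomial (I : {pred S}) (B : 'X_{1..n} -> Prop) k :
  I =i monomial_ideal B -> ideal_exp I k =i monomial_ideal (msums B k).
Proof.
move=> IB f; apply/idP/idP => [/asboolP[s sI ->]|/asboolP[s sB ->]].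
  rewrite big_seq; apply: rpred_sum => p /sI[t tI ->].
  apply: mem_mull; have {tI} : {subset tval t <= I} by [].
  case: t => /= t /eqP <-; elim: t => [|y t IHt] tI.
    by rewrite big_nil -mpolyX0; apply: mem_monomial_idealX.
  rewrite big_cons; apply: (@monomial_idealM B (msums B (size t))).
  - by move=> u v Bu tv; exists u, v.
  - by rewrite -IB tI // mem_head.
  - by apply: IHt => z zt; rewrite tI // in_cons zt orbT.
rewrite big_seq; apply: rpred_sum => p /sB[u ku ->]; apply: mem_mull.
elim: k u ku {s sB} => [|k IHk] u; first by move=> ->; apply: ideal_exp0.
move=> [v [w [Bv /IHk kw ->]]]; rewrite mpolyXD -add1n; apply: ideal_expM => //.
apply: mem_ideal_span; exists [tuple 'X_[v]]; last by rewrite big_seq1.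
by move=> z; rewrite inE => /eqP ->; rewrite IB mem_monomial_idealX.
Qed.

(** The exponent of the image of [x^u] when each [x_j] is replaced by [x_(g j)]. *)
Definition mnm_push (g : 'I_n -> 'I_n) u :=
  [multinom (\sum_(j | g j == i) u j)%N | i < n].

Definition mpush (g : 'I_n -> 'I_n) f : S := f \mPo [tuple 'X_(g i) | i < n].

HB.instance Definition _ g := GRing.RMorphism.copy (mpush g)
  (comp_mpoly [tuple 'X_(g i) | i < n]).

Lemma mpushX g u : mpush g 'X_[u] = 'X_[mnm_push g u].
Proof.
rewrite /mpush comp_mpolyX [RHS]mpolyXE_id.
rewrite (partition_big g xpredT) //=; apply: eq_bigr => i _.
rewrite mnmE -prodrXr; apply: eq_big => // j /eqP <-.
by rewrite tnth_mktuple.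
Qed.

Lemma mpushXU g i : mpush g 'X_i = 'X_(g i).
Proof. by rewrite /mpush comp_mpolyXU -tnth_nth tnth_mktuple. Qed.

Lemma mdeg_push g u : mdeg (mnm_push g u) = mdeg u.
Proof.
rewrite !mdegE [RHS](partition_big g xpredT) //=.
by apply: eq_bigr => i _; rewrite mnmE.
Qed.

Lemma mpush_monomial_ideal g U f : f \in monomial_ideal U ->
  mpush g f \in monomial_ideal (fun m => exists2 u, U u & m = mnm_push g u).
Proof.
move=> /asboolP[s sU ->]; rewrite rmorph_sum big_seq.
apply: rpred_sum => p /sU[u Uu ->].
rewrite rmorphM /=; apply: mem_mull.
by rewrite mpushX; apply: mem_ideal_span; exists (mnm_push g u) => //; exists u.
Qed.

(** If [m + z] is not in the support of the product, cancellation forces [m + z = m' + y] with [m']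
    in the support of [f] and of larger z-exponent. These exponents are bounded, so induction gives
    [m'], then [m + z], then [m]. *)
Lemma mulXB_regular (A : 'X_{1..n} -> Prop) (y z : 'I_n) f : y != z ->
  (forall m, A m -> A (m + U_(y))%MM) -> (forall m, A (m + U_(z))%MM -> A m) ->
  (forall m, m \in msupp (('X_y - 'X_z) * f) -> A m) ->
  forall m, m \in msupp f -> A m.
Proof.
move=> yz Ay Az fA m; have [k] := ubnP (msize f - m z)%N.
elim: k => // k IHk in m * => lt_k fm.
have lt_mz (m' : 'X_{1..n}) : m' \in msupp f -> (m' z < msize f)%N.
  move=> /msize_mdeg_lt; apply: leq_ltn_trans.
  by rewrite mdegE (bigD1 z) //= leq_addr.
apply: Az.
have [/fA //|] := boolP (m + U_(z) \in msupp (('X_y - 'X_z) * f))%MM.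
rewrite mcoeff_msupp negbK mulrBl mcoeffB ['X_z * f]mulrC addmC mcoeffMX.
rewrite subr_eq0 ['X_y * f]mulrC => /eqP fE.
have: (U_(z) + m)%MM \in msupp (f * 'X_y).
  by rewrite mcoeff_msupp fE -mcoeff_msupp.
rewrite (perm_mem (msuppMX _ _)) => /mapP[m' fm' mE].
have mz : m' z = (m z).+1.
  by move/mnmP/(_ z): mE; rewrite !mnmDE !mnm1E eqxx (negPf yz) add0n => <-.
rewrite mE addmC; apply/Ay/IHk => //.
have := lt_mz _ fm'; rewrite mz; lia.
Qed.

End MonomialIdeals.

(** * The regular sequence of differences and its socle element *)

Section PolymatroidalDepth.
Local Open Scope quotient_scope.
Variables (K : fieldType) (n d : nat) (B : 'X_{1..n} -> Prop).
Variables (b : 'X_{1..n}) (i0 : 'I_n) (I : {pred {mpoly K[n]}}).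
Hypotheses (Bexchange : base_exchange B) (Bdeg : forall u, B u -> mdeg u = d).
Hypotheses (Bb : B b) (b_i0 : (0 < b i0)%N) (IB : I =i monomial_ideal B).
Local Notation S := {mpoly K[n]}.
Local Notation rep := (link_rep B).
Local Notation y0 := (rep i0).

(** The n - c + 1 coordinates that determine a sum of bases; the remaining indices are the c - 1
    representatives other than [y0]. *)
Definition free_index : pred 'I_n := [pred i | (rep i != i) || (i == y0)].

Definition other_reps := [seq i <- enum 'I_n | ~~ free_index i].

Lemma mem_other_reps i : (i \in other_reps) = (rep i == i) && (i != y0).
Proof. by rewrite mem_filter mem_enum negb_or negbK andbT. Qed.

Lemma other_reps_uniq : uniq other_reps.
Proof. exact/filter_uniq/enum_uniq. Qed.

Lemma card_free_index : (#|free_index| + size other_reps)%N = n.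
Proof.
rewrite -[RHS](card_ord n) -(cardC free_index); congr (_ + _)%N.
rewrite -(card_uniqP other_reps_uniq); apply: eq_card => i.
by rewrite !inE mem_filter mem_enum andbT.
Qed.

Definition rep_diffs : seq S := [seq 'X_y0 - 'X_y | y <- other_reps].

Lemma size_rep_diffs : size rep_diffs = size other_reps.
Proof. exact: size_map. Qed.

Lemma rep_diffs_nth i : (i < size other_reps)%N ->
  rep_diffs`_i = 'X_y0 - 'X_(nth y0 other_reps i).
Proof. by move=> lt_i; rewrite (nth_map y0). Qed.

Definition collapse k (i : 'I_n) := if i \in take k other_reps then y0 else i.

Lemma collapse_y0 k : collapse k y0 = y0.
Proof. by rewrite /collapse; case: ifP. Qed.

(** The property is stable under sums and products, so constants and variables suffice. *)
Lemma in_span_collapse k f : (k <= size other_reps)%N ->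
  in_span (take k rep_diffs) (f - mpush (collapse k) f).
Proof.
move=> le_k; set s := take k _.
pose P f := in_span s (f - mpush (collapse k) f); rewrite -/(P f).
have PM g h : P g -> P h -> P (g * h).
  move=> Pg Ph; rewrite /P rmorphM /=.
  have -> : g * h - mpush (collapse k) g * mpush (collapse k) h =
      g * (h - mpush (collapse k) h) +
      mpush (collapse k) h * (g - mpush (collapse k) g) by ring.
  by apply: in_spanD; apply: in_spanM.
have PC c : P c%:MP by rewrite /P /mpush comp_mpolyC subrr; apply: in_span0.
have PX i : P 'X_i.
  rewrite /P mpushXU /collapse; case: ifP => [|_]; last first.
    by rewrite subrr; apply: in_span0.
  move=> i_k; pose j := index i (take k other_reps).
  have lt_jk : (j < k)%N.
    by rewrite -[X in (_ < X)%N](size_takel le_k) index_mem.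
  have js : (j < size s)%N by rewrite size_takel ?size_rep_diffs.
  have := in_spanM (-1) (in_span_nth js).
  rewrite nth_take // rep_diffs_nth ?(leq_trans lt_jk) //.
  by rewrite -(nth_take y0 lt_jk) nth_index // mulN1r opprB.
have PXm m : P 'X_[m].
  rewrite mpolyXE_id; apply: (big_ind P) => [||i _]; [exact: PC|exact: PM|].
  by elim: (m i) => [|a IHa]; [exact: PC | rewrite exprS; apply: PM].
rewrite [f]mpolyE; apply: (big_ind P) => [|g h Pg Ph|m _]; first exact: PC.
  by rewrite /P rmorphD /= opprD addrACA; apply: in_spanD.
by rewrite -mul_mpolyC; apply: PM.
Qed.

Definition collapsed_monomials k i (m : 'X_{1..n}) :=
  exists2 u, msums B k u & m = mnm_push (collapse i) u.

(** Dividing by the first [i] differences amounts to substituting [y0] for the first [i] other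
    representatives, so membership can be tested on supports against a monomial ideal of [S]. *)
Lemma in_smul_quot_collapse k i (f : S) : (i <= size other_reps)%N ->
  in_smul (take i rep_diffs) (\pi_{ideal_quot (ideal_exp I k)} f) <->
  mpush (collapse i) f \in monomial_ideal (collapsed_monomials k i).
Proof.
move=> le_i; split.
  move=> /in_smul_quot[r]; rewrite (ideal_exp_monomial k IB) => rJ [w fE].
  rewrite -[f](subrK r) fE rmorphD rpredD //; last exact: mpush_monomial_ideal.
  rewrite rmorph_sum big1 ?rpred0 // => j _.
  rewrite /GRing.scale /= rmorphM /=.
  have lt_j : (j < i)%N.
    by rewrite (leq_trans (ltn_ord j)) // size_takel ?size_rep_diffs.
  rewrite nth_take // rep_diffs_nth ?(leq_trans lt_j) // rmorphB /=.
  rewrite !mpushXU collapse_y0 /collapse.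
  rewrite -(nth_take y0 lt_j) mem_nth ?subrr ?mul0r //.
  by rewrite [X in (_ < X)%N]size_takel.
move=> /asboolP[s sJ fE]; apply/in_smul_quot.
suff [r rJ sr] : exists2 r, r \in ideal_exp I k &
    in_span (take i rep_diffs) (\sum_(p <- s) p.1 * p.2 - r).
  exists r => //; have := in_spanD (in_span_collapse f le_i) sr.
  by rewrite fE addrA subrK.
elim: s sJ {fE} => [|p s IHs] sJ.
  by exists 0; [apply: rpred0 | rewrite big_nil subrr; apply: in_span0].
have [|r rJ sr] := IHs.
  by move=> q qs; apply: sJ; rewrite in_cons qs orbT.
have [_ [u ku ->] p2] := sJ p (mem_head _ _).
exists (p.1 * 'X_[u] + r).
  rewrite rpredD // mem_mull // (ideal_exp_monomial k IB).
  exact: mem_monomial_idealX.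
rewrite big_cons opprD addrACA; apply: in_spanD => //.
rewrite p2 -mulrBr -[_ - _]opprB -mulN1r mulrA; apply: in_spanM.
by rewrite -mpushX; apply: in_span_collapse.
Qed.

Lemma collapse_regular k i (f : S) : (i < size other_reps)%N ->
  ('X_y0 - 'X_(nth y0 other_reps i)) * f \in
    monomial_ideal (collapsed_monomials k i) ->
  f \in monomial_ideal (collapsed_monomials k i).
Proof.
set z := nth _ _ _ => lt_i /monomial_idealP fJ.
(* The union of the classes merged so far: it contains [y0] but not [z], and [collapse i] preserves
   it and its complement. *)
pose C := [pred a | rep a \in y0 :: take i other_reps].
have clC : link_closed B C.
  exact: (@link_rep_closed _ _ (mem (y0 :: take i other_reps))).
have z_reps : z \in other_reps by rewrite mem_nth.
have [/eqP rz zy0] : rep z == z /\ z != y0.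
  by apply/andP; rewrite -mem_other_reps.
have zC : z \notin C.
  rewrite inE rz in_cons negb_or zy0 /=.
  by rewrite in_take // index_uniq ?other_reps_uniq // ltnn.
have y0C : y0 \in C by rewrite inE link_rep_id mem_head.
have colC a : (collapse i a \in C) = (a \in C).
  rewrite /collapse; case: ifP => // ai; rewrite y0C !inE.
  have /eqP-> : rep a == a.
    by have := mem_take ai; rewrite mem_other_reps => /andP[].
  by rewrite ai orbT.
pose push := mnm_push (collapse i).
pose A (D : {pred 'I_n}) (m : 'X_{1..n}) := exists2 u, msums B k u &
  forall a, a \in D -> (push u a <= m a)%N.
have Aadd D m a : A D m -> A D (m + U_(a))%MM.
  by move=> [u ku um]; exists u => // c /um; rewrite mnmDE; lia.
have Asub (D : {pred 'I_n}) m a : a \notin D -> A D (m + U_(a))%MM -> A D m.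
  move=> aD [u ku um]; exists u => // c cD; have := um c cD.
  by rewrite mnmDE mnm1E; case: eqVneq cD aD => [->->|] //; lia.
have fA D m : m \in msupp (('X_y0 - 'X_z) * f) -> A D m.
  move=> /fJ[_ [u ku ->] /mnm_lepP le_u]; exists u => // a _; exact: le_u.
(* The condition on [C] ignores the exponent of [z], the one on its complement that of [y0]; each
   thus passes from the product to [f]. *)
have AC : forall m, m \in msupp f -> A C m.
  apply: (mulXB_regular (y := y0) (z := z)); rewrite 1?eq_sym //.
  - by move=> m; apply: Aadd.
  - by move=> m; apply: Asub.
  - exact: fA.
have AC' : forall m, m \in msupp f -> A [predC C] m.
  apply: (mulXB_regular (y := z) (z := y0)) => //.
  - by move=> m; apply: Aadd.
  - by move=> m; apply: Asub; rewrite inE negbK.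
  - move=> m; rewrite -opprB mulNr (perm_mem (msuppN _)); exact: fA.
apply/monomial_idealP => m fm.
(* The two conditions have separate witnesses; mixing them along [C] gives a single one. *)
have [u ku um] := AC m fm; have [v kv vm] := AC' m fm.
exists (push (mnm_mix C u v)).
  by exists (mnm_mix C u v) => //; apply: msums_mix.
apply/mnm_lepP => a; rewrite mnmE.
case: (boolP (a \in C)) => aC; [have := um a aC | have := vm a aC];
  apply: leq_trans; rewrite mnmE;
  apply/eq_leq/eq_bigr => c /eqP ca; rewrite mnmE -colC ca ?aC //.
by rewrite (negPf aC).
Qed.

Lemma polymatroidal_depth : exists k0, forall k, (k0 <= k)%N ->
  is_depth {ideal_quot (ideal_exp I k)} (@irrelevant_ideal K n)
    (size other_reps).
Proof.
have [k0 k0P] := exists_central_msum Bb b_i0.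
exists k0 => k /k0P[u [ku u_y0 uP]]; rewrite -size_rep_diffs.
have u0 : (U_(y0) <= u)%MM by rewrite lep1mP -lt0n.
(* Collapsing preserves degrees, and [u - U_(y0)] has degree below that of the generators. *)
have nw : ~ in_smul rep_diffs
    (\pi_{ideal_quot (ideal_exp I k)} 'X_[u - U_(y0)] :
      {ideal_quot (ideal_exp I k)}).
  rewrite -[X in in_smul X _]take_size size_rep_diffs.
  rewrite in_smul_quot_collapse // mpushX => /monomial_idealX_le[_ [v kv ->]].
  move=> /mnm_lepP le_v; suff: (mdeg u <= mdeg (u - U_(y0))%MM)%N.
    by rewrite -{1}(submK u0) mdegD mdeg1 addn1 ltnn.
  rewrite (mdeg_msums Bdeg ku) -(mdeg_msums Bdeg kv).
  rewrite -(mdeg_push (collapse (size other_reps)) v).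
  rewrite -(mdeg_push (collapse (size other_reps)) (u - U_(y0))%MM) !mdegE.
  exact: leq_sum.
apply: (@is_depth_quot _ _ n (fun i => 'X_i) _ _ 'X_[u - U_(y0)]) => //.
- move=> f /asboolP[s sX ->]; elim: s sX => [|p s IHs] sX.
    by exists (fun=> 0); rewrite big_nil big1 // => i _; rewrite mul0r.
  have [|c cE] := IHs; first by move=> q qs; apply: sX; rewrite in_cons qs orbT.
  have [i p2] := sX p (mem_head _ _).
  exists (fun j => (if j == i then p.1 else 0) + c j).
  rewrite big_cons cE p2; under [RHS]eq_bigr do rewrite mulrDl.
  rewrite big_split /=; congr (_ + _); rewrite (bigD1 i) //= eqxx.
  by rewrite big1 ?addr0 // => j /negPf->; rewrite mul0r.
- move=> f /mapP[y _ ->]; rewrite rpredB //; apply: mem_ideal_span.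
    by exists y0.
  by exists y.
- move=> i f; rewrite size_rep_diffs => lt_i fJ.
  apply/(in_smul_quot_collapse k _ (ltnW lt_i)).
  move/(in_smul_quot_collapse k _ (ltnW lt_i)): fJ; rewrite rmorphM /=.
  rewrite rep_diffs_nth // rmorphB /= !mpushXU collapse_y0.
  rewrite {1}/collapse in_take ?index_uniq ?other_reps_uniq ?mem_nth //.
  by rewrite ltnn; apply: collapse_regular.
- move=> i.
  (* By the choice of [u], [x_i x^u / y0] equals [x_(rep i) x^v / y0]. This is [x^v] if
     [rep i = y0], and otherwise congruent to it modulo [y0 - x_(rep i)]. *)
  have [v kv vE] := uP i; apply/in_smul_quot; exists 'X_[v].
    by rewrite (ideal_exp_monomial k IB) mem_monomial_idealX.
  have [ri|ri] := eqVneq (rep i) y0.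
    rewrite -mpolyXD (_ : U_(i) + _ = v)%MM ?subrr; first exact: in_span0.
    apply/mnmP => a; move/mnmP/(_ a): vE; move/mnm_lepP/(_ a): u0.
    by rewrite ri !mnmDE mnmBE; lia.
  have v0 : (U_(y0) <= v)%MM.
    rewrite lep1mP -lt0n; move/mnmP/(_ y0): vE.
    by rewrite !mnmDE !mnm1E (negPf ri); lia.
  have -> : 'X_i * 'X_[u - U_(y0)] = 'X_(rep i) * 'X_[v - U_(y0)] :> S.
    rewrite -!mpolyXD; congr 'X_[_]; apply/mnmP => a; move/mnmP/(_ a): vE.
    move/mnm_lepP/(_ a): u0; move/mnm_lepP/(_ a): v0.
    by rewrite !mnmDE !mnmBE; lia.
  rewrite -[in X in _ - X](submK v0) mpolyXD [X in _ - X]mulrC -mulrBl mulrC.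
  rewrite -opprB -mulN1r mulrA; apply: in_spanM.
  have: 'X_y0 - 'X_(rep i) \in rep_diffs.
    by apply: map_f; rewrite mem_other_reps link_rep_id eqxx ri.
  by move=> /(nthP 0)[j lt_j <-]; apply: in_span_nth.
Qed.

End PolymatroidalDepth.

(** * Krull dimension of the fiber ring *)

Fixpoint exponents (r N : nat) : seq (seq nat) :=
  if r is r'.+1 then [seq a :: e | a <- iota 0 N, e <- exponents r' N]
  else [:: [::]].

Lemma size_exponents r N : size (exponents r N) = (N ^ r)%N.
Proof. by elim: r => //= r IHr; rewrite size_allpairs size_iota IHr expnS. Qed.

Lemma exponents_uniq r N : uniq (exponents r N).
Proof.
elim: r => //= r IHr; apply: allpairs_uniq => //; first exact: iota_uniq.
by move=> [a e] [a' e'] _ _ [-> ->].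
Qed.

Section MonomialValue.
Variable A : comNzRingType.

Fixpoint monomial_value (x : seq A) (e : seq nat) : A :=
  match x, e with
  | y :: x', a :: e' => y ^+ a * monomial_value x' e'
  | _, _ => 1
  end.

(** [G a] is the value of the coefficient of [y ^+ a], and [Z a] says that this coefficient vanishes
    formally. The constant term lies in [q] because [y] does; once it is gone, [y] cancels modulo
    [p]. *)
Lemma prime_ideal_coefs (p q : {pred A}) (y : A) (Z : nat -> Prop)
    (G : nat -> A) N :
  prime_ideal p -> prime_ideal q -> {subset p <= q} -> y \in q -> y \notin p ->
  (forall a, G a \in q -> Z a) -> (forall a, Z a -> G a = 0) ->
  \sum_(a < N) y ^+ a * G a \in p -> forall a, (a < N)%N -> Z a.
Proof.
move=> [[p0 _ pD] pM] [[q0 _ qD] qM] pq yq yp.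
elim: N G Z => // N IHN G Z GZ ZG; rewrite big_ord_recl mul1r => sp.
have sumE : \sum_(i < N) y ^+ lift ord0 i * G (lift ord0 i) =
    y * \sum_(i < N) y ^+ i * G i.+1.
  by rewrite mulr_sumr; apply: eq_bigr => i _; rewrite mulrA -exprS.
rewrite sumE in sp.
have Z0 : Z 0%N.
  apply: GZ; set T := \sum_(i < _) _ in sp *.
  have := qD (- T) _ _ yq (pq _ sp); congr (_ \in q).
  by rewrite mulNr mulrC addrC addrK.
move: sp; rewrite ZG // add0r => /pM; rewrite (negPf yp) /= => sp [|a] //.
exact: (IHN (fun i => G i.+1) (fun i => Z i.+1) (fun i => GZ i.+1)
  (fun i => ZG i.+1) sp).
Qed.

(* If a polynomial in x_0, ..., x_(r-1) has its value in p_0, write it as a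
   polynomial in x_0: its constant coefficient lies in p_1, hence is zero by
   induction, and x_0 can be cancelled modulo p_0. *)
Lemma prime_chain_independent (K : fieldType) (kappa : K -> A) (N : nat)
    (x : seq A) (p : nat -> {pred A}) (c : seq nat -> K) :
  kappa 0 = 0 -> (forall a, a != 0 -> exists y, y * kappa a = 1) ->
  (forall i, (i <= size x)%N -> prime_ideal (p i)) ->
  (forall i, (i < size x)%N ->
     [/\ {subset p i <= p i.+1}, x`_i \in p i.+1 & x`_i \notin p i]) ->
  \sum_(e <- exponents (size x) N) kappa (c e) * monomial_value x e \in p 0%N ->
  forall e, e \in exponents (size x) N -> c e = 0.
Proof.
move=> k0 kU; elim: x p c => [|y x IHx] p c pp px /=.
  rewrite big_seq1 mulr1 => cp e; rewrite inE => /eqP->; apply/eqP.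
  apply: contraT => /kU[z zE]; have [[p0 p1 pD] _] := pp 0%N isT.
  by case/negP: p1; rewrite -zE -[_ * _]addr0; apply: pD.
rewrite big_allpairs_dep => sp e /allpairsP[[a e'] /= [aN e'x ->]].
have [sub yq yp] := px 0%N isT.
move: a aN {e} e' e'x; suff: forall a, (a < N)%N -> forall e,
    e \in exponents (size x) N -> c (a :: e) = 0.
  by move=> cE a; rewrite mem_iota add0n => /andP[_ /cE].
apply: (@prime_ideal_coefs (p 0%N) (p 1%N) y _ (fun a => \sum_(e <- _)
  kappa (c (a :: e)) * monomial_value x e)) => //.
- exact: pp.
- exact: pp.
- move=> a; apply: (IHx (fun i => p i.+1) (fun e => c (a :: e))).
    by move=> i ix; apply: pp.
  by move=> i ix; apply: (px i.+1).
- by move=> a cE; rewrite big_seq big1 // => e /cE->; rewrite k0 mul0r.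
- move: sp; rewrite -[N in iota _ N]subn0 big_mkord; congr (_ \in p 0%N).
  apply: eq_bigr => a _; rewrite mulr_sumr; apply: eq_bigr => e _ /=.
  by rewrite mulrCA.
Qed.

End MonomialValue.

Lemma rmorph_monomial_value (A A' : comNzRingType) (h : {rmorphism A -> A'})
    x e :
  h (monomial_value x e) = monomial_value (map h x) e.
Proof.
elim: x e => [|y x IHx] [|a e] /=; rewrite ?rmorph1 //.
by rewrite rmorphM rmorphXn IHx.
Qed.

(** The coefficient matrix has more rows than columns, hence a nonzero left kernel. *)
Lemma mpoly_linear_dependence (K : fieldType) (n : nat) (T : eqType) (L : seq T)
    (v : T -> {mpoly K[n]}) (W : seq 'X_{1..n}) :
  uniq L -> (size W < size L)%N ->
  (forall t, t \in L -> {subset msupp (v t) <= W}) ->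
  exists c : T -> K, (exists2 t, t \in L & c t != 0) /\
    \sum_(t <- L) c t *: v t = 0.
Proof.
case: L => // t0 L'; set L := t0 :: L' => uL ltWL vW.
pose M := \matrix_(i < size L, j < size W) (v (nth t0 L i))@_(nth 0%MM W j).
pose w := nz_row (kermx M).
have w0 : w != 0.
  rewrite nz_row_eq0 -mxrank_eq0 mxrank_ker -lt0n subn_gt0.
  by rewrite (leq_ltn_trans (rank_leq_col M)).
have wM : w *m M = 0 by apply/sub_kermxP/nz_row_sub.
pose c t := if insub (index t L) is Some i then w 0 i else 0.
have cE (i : 'I_(size L)) : c (nth t0 L i) = w 0 i.
  by rewrite /c index_uniq // valK.
exists c; split.
  have [i wi] := rV0Pn _ w0.
  by exists (nth t0 L i); rewrite ?mem_nth ?cE.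
apply/mpolyP => m; rewrite mcoeff0 raddf_sum (big_nth t0) big_mkord /=.
have [mW|mW] := boolP (m \in W); last first.
  rewrite big1 // => i _; rewrite mcoeffZ [X in _ * X](_ : _ = 0) ?mulr0 //.
  by apply/eqP; rewrite mcoeff_eq0; apply: contra mW; apply/vW/mem_nth.
have jW : (index m W < size W)%N by rewrite index_mem.
have wMm : \sum_i w 0 i * M i (Ordinal jW) = 0.
  by have := congr1 (fun u : 'rV_(size W) => u 0 (Ordinal jW)) wM; rewrite !mxE.
rewrite -[RHS]wMm; apply: eq_bigr => i _.
by rewrite mcoeffZ cE !mxE /= nth_index.
Qed.

Lemma mcoeff_pihomog (R : comNzRingType) (n d : nat) (f : {mpoly R[n]}) m :
  (pihomog mdeg d f)@_m = if mdeg m == d then f@_m else 0.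
Proof.
have fE : f@_m = \sum_(m' <- msupp f) f@_m' * (m' == m)%:R.
  rewrite {1}[f]mpolyE raddf_sum; apply: eq_bigr => m' _.
  by rewrite /= mcoeffZ mcoeffX.
rewrite pihomogE raddf_sum big_mkcond fE /=.
case: ifP => dm; [apply: eq_bigr | rewrite big1 //] => m' _;
  case: ifP => dm' //=; rewrite ?mcoeffZ ?mcoeffX //;
  case: eqVneq => [mE|_]; rewrite ?mulr0 //; by rewrite mE dm in dm'.
Qed.

(** The degrees [a] and [b] are the lowest possible, so only these components contribute in degree
    [a + b]. *)
Lemma pihomogM (R : comNzRingType) (n a b : nat) (f g : {mpoly R[n]}) :
  (forall m, m \in msupp f -> (a <= mdeg m)%N) ->
  (forall m, m \in msupp g -> (b <= mdeg m)%N) ->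
  pihomog mdeg (a + b) (f * g) = pihomog mdeg a f * pihomog mdeg b g.
Proof.
move=> fa gb; rewrite !(pihomogE _ a, pihomogE _ b).
rewrite [f in LHS]mpolyE [g in LHS]mpolyE big_distrlr /=.
rewrite [X in X * _]big_mkcond [X in _ * X]big_mkcond big_distrlr /= linear_sum.
rewrite big_seq [RHS]big_seq; apply: eq_bigr => m /fa le_m; rewrite linear_sum.
rewrite big_seq [RHS]big_seq; apply: eq_bigr => m' /gb le_m'.
rewrite -scalerAl -scalerAr -mpolyXD !linearZ /= pihomogX /= mdegD.
case: eqP => [E|nE].
  have [-> ->] : mdeg m = a /\ mdeg m' = b by lia.
  by rewrite !eqxx -scalerAl -scalerAr -mpolyXD.
case: eqP => [mE|]; last by rewrite mul0r !scaler0.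
by case: eqP => [mE'|]; [lia | rewrite mulr0 !scaler0].
Qed.

Section MonomialPush.
Variables (K : fieldType) (n : nat).
Implicit Types (f : {mpoly K[n]}) (g h : 'I_n -> 'I_n) (u : 'X_{1..n}).

Lemma mnm_pushD g u v :
  mnm_push g (u + v)%MM = (mnm_push g u + mnm_push g v)%MM.
Proof.
apply/mnmP => i; rewrite mnmDE !mnmE -big_split.
by apply: eq_bigr => j _; rewrite mnmDE.
Qed.

Lemma mnm_push1 g i : mnm_push g U_(i) = U_(g i)%MM.
Proof.
apply/mnmP => j; rewrite mnmE mnm1E; case: eqVneq => [gij|ne].
  rewrite (bigD1 i) ?gij //= mnm1E eqxx big1 // => l /andP[_ li].
  by rewrite mnm1E eq_sym (negPf li).
rewrite big1 // => l /eqP gl; rewrite mnm1E; case: eqP => // il.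
by rewrite il gl eqxx in ne.
Qed.

Lemma mnm_push_comp g h u : mnm_push g (mnm_push h u) = mnm_push (g \o h) u.
Proof.
apply/mnmP => j; rewrite !mnmE [RHS](partition_big h (fun i => g i == j)) //=.
apply: eq_bigr => i gi; rewrite mnmE; apply: eq_bigl => l.
by case: eqP => [->|_]; rewrite ?gi ?andbF.
Qed.

Lemma mpushZX g c u :
  mpush g (c *: 'X_[u]) = c *: 'X_[mnm_push g u] :> {mpoly K[n]}.
Proof. by rewrite -!mul_mpolyC rmorphM /= mpushX /mpush comp_mpolyC. Qed.

Lemma mpush_comp g h f : mpush g (mpush h f) = mpush (g \o h) f.
Proof.
rewrite [f]mpolyE (rmorph_sum (mpush h)) (rmorph_sum (mpush g)).
rewrite [RHS]rmorph_sum /=; apply: eq_bigr => m _.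
by rewrite !mpushZX mnm_push_comp.
Qed.

Lemma mcoeff0_mpush g f : (mpush g f)@_0 = f@_0.
Proof.
rewrite [f]mpolyE (rmorph_sum (mpush g)) !raddf_sum /=.
apply: eq_bigr => m _; rewrite mpushZX !mcoeffZ !mcoeffX.
by rewrite -!mdeg_eq0 mdeg_push.
Qed.

End MonomialPush.

Lemma prime_ideal_kernel (A : comNzRingType) (D : idomainType)
    (h : {rmorphism A -> D}) : prime_ideal [pred x | h x == 0].
Proof.
split=> [|x y]; last by rewrite !inE rmorphM mulf_eq0.
split=> [||a x y]; rewrite !inE ?rmorph0 ?rmorph1 ?oner_eq0 //.
by move=> /eqP x0 /eqP y0; rewrite rmorphD rmorphM x0 y0 mulr0 addr0.
Qed.

(** * The fiber ring as a monomial algebra *)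

Section FiberRing.
Local Open Scope quotient_scope.
Variables (K : fieldType) (n d : nat) (B : 'X_{1..n} -> Prop).
Variables (b : 'X_{1..n}) (i0 : 'I_n) (I : {pred {mpoly K[n]}}).
Hypotheses (Bexchange : base_exchange B) (Bdeg : forall u, B u -> mdeg u = d).
Hypotheses (Bb : B b) (b_i0 : (0 < b i0)%N) (IB : I =i monomial_ideal B).
Local Notation S := {mpoly K[n]}.
Local Notation rep := (link_rep B).
Local Notation y0 := (rep i0).
Implicit Types (f g : rees I).

Lemma base_degree_gt0 : (0 < d)%N.
Proof. by rewrite -(Bdeg Bb) mdegE (bigD1 i0) //= addn_gt0 b_i0. Qed.

Lemma mem_reesP p :
  p \in rees_pred I <-> forall k, p`_k \in monomial_ideal (msums B k).
Proof.
split=> [/asboolP pI k|pI]; first by rewrite -(ideal_exp_monomial k IB).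
by apply/asboolP => k; rewrite (ideal_exp_monomial k IB).
Qed.

Lemma rees_valM f g : rees_val (f * g) = rees_val f * rees_val g.
Proof. by []. Qed.

Lemma rees_coefP f k m : m \in msupp (rees_val f)`_k ->
  exists2 u, msums B k u & (u <= m)%MM.
Proof. by move/mem_reesP: (rees_valP f) => /(_ k)/monomial_idealP; apply. Qed.

Lemma rees_coef_mdeg f k m : m \in msupp (rees_val f)`_k -> (k * d <= mdeg m)%N.
Proof.
move=> /rees_coefP[u ku /mnm_lepP le_um]; rewrite -(mdeg_msums Bdeg ku) !mdegE.
exact: leq_sum.
Qed.

(** The element [g t^k] of the Rees algebra, with default 0 when [g] is not in the k-th power of
    [I]. *)
Definition rees_term k (g : S) : rees I := insubd 0 (g%:P * 'X^k).

Lemma val_rees_term k (g : S) : g \in monomial_ideal (msums B k) ->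
  rees_val (rees_term k g) = g%:P * 'X^k.
Proof.
move=> gk; rewrite -[rees_val _]/(val _) insubdK //; apply/mem_reesP => l.
by rewrite coefCM coefXn; case: eqP => [->|_]; rewrite ?mulr1 ?mulr0 ?rpred0.
Qed.

Definition initial_poly f : {poly S} :=
  \poly_(k < size (rees_val f)) pihomog mdeg (k * d) (rees_val f)`_k.

Lemma coef_initial_poly f k :
  (initial_poly f)`_k = pihomog mdeg (k * d) (rees_val f)`_k.
Proof.
rewrite coef_poly; case: ltnP => // le_fk.
by rewrite [X in pihomog _ _ X]nth_default ?raddf0.
Qed.

(* The generator x^u t^k of the fiber ring is sent to x^u: since |u| = kd and
   d > 0, the exponent k can be recovered from x^u. *)
Definition initial_form f : S := (initial_poly f).[1].

Lemma initial_form_is_zmod_morphism : zmod_morphism initial_form.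
Proof.
move=> f g; rewrite /initial_form -hornerN -hornerD; congr _.[1].
apply/polyP => k; rewrite coefB !coef_initial_poly -raddfB -coefB.
by [].
Qed.

(** The coefficient of [t^k] has no monomial of degree below [k * d], so lowest components
    multiply. *)
Lemma initial_form_is_monoid_morphism : monoid_morphism initial_form.
Proof.
split=> [|f g]; rewrite /initial_form -?hornerM.
  rewrite -[RHS](hornerC _ (1 : S)); congr _.[1].
  apply/polyP => k; rewrite coef_initial_poly -[rees_val 1]/(1 : {poly S}).
  rewrite !coefC; case: k => [|k] /=; last by rewrite raddf0.
  by rewrite -mpolyX0 pihomogX /= mdeg0.
congr _.[1]; apply/polyP => k.
rewrite coef_initial_poly rees_valM.
rewrite !coefM raddf_sum; apply: eq_bigr => i _ /=; rewrite !coef_initial_poly.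
rewrite -{1}(subnKC (leq_ord i)) mulnDl.
by apply: pihomogM => m; apply: rees_coef_mdeg.
Qed.

HB.instance Definition _ := GRing.isZmodMorphism.Build (rees I) S initial_form
  initial_form_is_zmod_morphism.
HB.instance Definition _ := GRing.isMonoidMorphism.Build (rees I) S initial_form
  initial_form_is_monoid_morphism.

Lemma mcoeff_initial_form f k m : mdeg m = (k * d)%N ->
  (initial_form f)@_m = (rees_val f)`_k@_m.
Proof.
move=> dm; rewrite /initial_form horner_poly raddf_sum /=.
have termE (i : nat) :
    (pihomog mdeg (i * d) (rees_val f)`_i * 1 ^+ i)@_m =
    if i == k then (rees_val f)`_k@_m else 0.
  rewrite expr1n mulr1 mcoeff_pihomog dm eqn_pmul2r ?base_degree_gt0 //.
  by rewrite eq_sym; case: eqP => // ->.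
under eq_bigr do rewrite termE; rewrite -big_mkcond /=.
have [lt_k|le_k] := ltnP k (size (rees_val f)).
  by rewrite (big_pred1 (Ordinal lt_k)).
rewrite big_pred0 => [|i]; first by rewrite nth_default ?mcoeff0.
by apply/eqP => ik; rewrite -ik leqNgt ltn_ord in le_k.
Qed.

Lemma initial_form_term k u : msums B k u ->
  initial_form (rees_term k 'X_[u]) = 'X_[u].
Proof.
move=> ku; rewrite /initial_form.
suff -> : initial_poly (rees_term k 'X_[u]) = 'X_[u]%:P * 'X^k.
  by rewrite hornerCM hornerXn expr1n mulr1.
apply/polyP => l; rewrite coef_initial_poly.
rewrite val_rees_term ?mem_monomial_idealX // !coefCM coefXn.
case: eqP => [->|_]; last by rewrite mulr0 raddf0.
by rewrite mulr1 pihomogX /= (mdeg_msums Bdeg ku) eqxx.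
Qed.

Lemma initial_form_msupp f m : m \in msupp (initial_form f) ->
  exists2 k, (k < size (rees_val f))%N & msums B k m.
Proof.
rewrite mcoeff_msupp /initial_form horner_poly raddf_sum => nz.
have [k] : exists k : 'I_(size (rees_val f)), 
    (pihomog mdeg (k * d) (rees_val f)`_k)@_m != 0.
  apply/existsP; apply: contraNT nz => /existsPn nz; rewrite big1 // => k _.
  by rewrite /= expr1n mulr1; apply/eqP/negPn.
rewrite mcoeff_pihomog; case: (mdeg m =P _) => [dm|_]; rewrite ?eqxx //.
rewrite -mcoeff_msupp => /rees_coefP[u ku le_um]; exists k => //.
suff <- : u = m by [].
rewrite -(submK le_um) -[LHS]add0m; congr (_ + _)%MM; apply/esym/eqP.
have := dm; rewrite -{1}(submK le_um) mdegD (mdeg_msums Bdeg ku) => /eqP.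
by rewrite -[X in _ == X]add0n eqn_add2r mdeg_eq0.
Qed.

(** The map [initial_form] thus embeds the fiber ring in [S]. A monomial term in degree k whose
    exponent is not itself a sum of k bases splits off a variable while staying in [I^k], so it lies
    in the extended ideal. *)
Lemma rees_irrelevant_initial f :
  (f \in @rees_irrelevant K n I) = (initial_form f == 0).
Proof.
apply/idP/idP => [/asboolP[s sJ ->]|/eqP f0].
  rewrite rmorph_sum big_seq big1 // => p.
  move=> /sJ[g /irrelevant_ideal_mcoeff0 g0 pg].
  rewrite rmorphM /= (_ : initial_form p.2 = 0) ?mulr0 //.
  rewrite /initial_form (_ : initial_poly p.2 = 0) ?horner0 //.
  apply/polyP => k; rewrite coef_initial_poly coef0 pg coefC.
  case: eqP => [->|_]; last by rewrite raddf0.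
  apply/mpolyP => m; rewrite mul0n mcoeff_pihomog mcoeff0 mdeg_eq0.
  by case: eqP => // ->.
have fE : f = \sum_(k < size (rees_val f)) \sum_(m <- msupp (rees_val f)`_k)
    rees_term k ((rees_val f)`_k@_m *: 'X_[m]).
  apply: val_inj; rewrite rmorph_sum /= -[LHS]/(rees_val f).
  rewrite -[LHS]coefK poly_def; apply: eq_bigr => k _.
  rewrite -[RHS]/(val _) rmorph_sum big_seq /= -mul_polyC.
  rewrite [X in X%:P]mpolyE big_seq.
  rewrite rmorph_sum mulr_suml; apply: eq_bigr => m /rees_coefP[u ku le_um].
  rewrite -[RHS]/(rees_val _) val_rees_term // -mul_mpolyC mem_mull //.
  by rewrite -(submK le_um) mpolyXD mem_mull ?mem_monomial_idealX.
rewrite fE; apply: rpred_sum => k _; rewrite big_seq; apply: rpred_sum => m fm.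
have [u ku le_um] := rees_coefP fm.
(* If [m] were equal to [u], it would have degree [k * d] and its coefficient would survive in
   [initial_form f]. *)
have [i lt_i] : exists i, (u i < m i)%N.
  apply/existsP; apply: contraT => /existsPn le_mu.
  have uE : u = m.
    apply/mnmP => i; apply/eqP; rewrite eqn_leq (mnm_lepP le_um).
    by rewrite leqNgt le_mu.
  move: fm; rewrite mcoeff_msupp -mcoeff_initial_form ?f0 ?mcoeff0 ?eqxx //.
  by rewrite -uE (mdeg_msums Bdeg ku).
have le_im : (U_(i) <= m)%MM by rewrite lep1mP -lt0n (leq_ltn_trans _ lt_i).
have le_ui : (u <= m - U_(i))%MM.
  apply/mnm_lepP => j; rewrite mnmBE mnm1E; have := mnm_lepP le_um j.
  by case: eqVneq lt_i => [<-|_] /=; lia.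
set c := _@_m; have gk : c *: 'X_[m - U_(i)] \in monomial_ideal (msums B k).
  rewrite -(submK le_ui) mpolyXD scalerAl mem_mull ?mem_monomial_idealX //.
have xP : ('X_i)%:P \in rees_pred I.
  apply/mem_reesP => l; rewrite coefC; case: eqP => [->|_]; last exact: rpred0.
  by rewrite -['X_i]mulr1 mem_mull // -mpolyX0 mem_monomial_idealX.
have -> : rees_term k (c *: 'X_[m]) =
    rees_term k (c *: 'X_[m - U_(i)]) * Rees xP.
  apply: (val_inj : injective (@rees_val _ I)).
  have gm : c *: 'X_[m] \in monomial_ideal (msums B k).
    by rewrite -(submK le_um) mpolyXD scalerAl mem_mull ?mem_monomial_idealX.
  apply: etrans (val_rees_term gm) _; apply: esym.
  apply: etrans (rees_valM _ _) _.
  rewrite (val_rees_term gk) /=.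
  by rewrite mulrAC -polyCM -scalerAl -mpolyXD submK.
apply: ideal_span_mull; apply: mem_ideal_span; exists 'X_i => //.
by apply: mem_ideal_span; exists i.
Qed.

Local Notation Q := (fiber_ring I).

Lemma initial_form_repr f : initial_form (repr (\pi_Q f)) = initial_form f.
Proof.
apply/eqP; rewrite -subr_eq0 -rmorphB -rees_irrelevant_initial.
by rewrite Quotient.idealrBE reprK.
Qed.

Definition fiber_form (q : Q) : S := initial_form (repr q).

Lemma fiber_form_pi f : fiber_form (\pi_Q f) = initial_form f.
Proof. exact: initial_form_repr. Qed.

Lemma fiber_form_is_zmod_morphism : zmod_morphism fiber_form.
Proof.
move=> x y; rewrite -[x]reprK -[y]reprK -raddfB !fiber_form_pi.
exact: raddfB.
Qed.

Lemma fiber_form_is_monoid_morphism : monoid_morphism fiber_form.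
Proof.
split=> [|x y]; first by rewrite -(rmorph1 \pi_Q) fiber_form_pi rmorph1.
rewrite -[x]reprK -[y]reprK -rmorphM !fiber_form_pi.
exact: rmorphM.
Qed.

HB.instance Definition _ := GRing.isZmodMorphism.Build Q S fiber_form
  fiber_form_is_zmod_morphism.
HB.instance Definition _ := GRing.isMonoidMorphism.Build Q S fiber_form
  fiber_form_is_monoid_morphism.

(** * A chain of primes of the expected length *)

Definition nonreps := [seq i <- enum 'I_n | rep i != i].

Lemma nonreps_uniq : uniq nonreps.
Proof. exact/filter_uniq/enum_uniq. Qed.

Lemma card_free_indexE : #|free_index B i0| = (size nonreps).+1.
Proof.
rewrite (cardD1 y0) inE eqxx orbT add1n; congr _.+1.
rewrite -(card_uniqP nonreps_uniq); apply: eq_card => i.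
rewrite !inE mem_filter mem_enum andbT.
by case: eqVneq => [->|_]; rewrite ?orbF //= link_rep_id eqxx.
Qed.

Definition partial_rep k (i : 'I_n) :=
  if i \in take k nonreps then rep i else i.

Lemma rep_notin_nonreps i : rep i \notin nonreps.
Proof. by rewrite mem_filter link_rep_id eqxx. Qed.

Lemma partial_rep_rep k i : partial_rep k (rep i) = rep i.
Proof.
rewrite /partial_rep; case: ifP => // /mem_take.
by rewrite (negPf (rep_notin_nonreps i)).
Qed.

Lemma partial_rep_comp k l i : (k <= l)%N ->
  partial_rep l (partial_rep k i) = partial_rep l i.
Proof.
move=> le_kl; rewrite {2}/partial_rep; case: ifP => // ik.
rewrite partial_rep_rep /partial_rep (_ : i \in _) //.
by move: ik; rewrite -(take_takel _ le_kl) => /mem_take.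
Qed.

(* For k up to the number of nonrepresentatives, the kernel of the map that
   identifies x_i with x_(rep i) for the first k nonrepresentatives i; after
   that, the irrelevant ideal of the fiber ring. *)
Definition chain_ideal k : {pred Q} :=
  if (k <= size nonreps)%N
  then [pred q | mpush (partial_rep k) (fiber_form q) == 0]
  else [pred q | (fiber_form q)@_0 == 0].

Lemma chain_ideal_prime k : prime_ideal (chain_ideal k).
Proof.
rewrite /chain_ideal; case: ifP => _.
  exact: (prime_ideal_kernel (mpush (partial_rep k) \o fiber_form)).
exact: (prime_ideal_kernel (mcoeff 0%MM \o fiber_form)).
Qed.

Lemma chain_ideal_sub k l : (k <= l)%N ->
  {subset chain_ideal k <= chain_ideal l}.
Proof.
move=> le_kl q; rewrite /chain_ideal; case: (leqP k) => k_n; last first.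
  by rewrite leqNgt (leq_trans k_n le_kl).
rewrite inE => /eqP q0; case: leqP => l_n; rewrite inE.
  have <- : partial_rep l \o partial_rep k = partial_rep l.
    by apply/funext => i /=; apply: partial_rep_comp.
  by rewrite -mpush_comp q0 rmorph0.
by rewrite -(mcoeff0_mpush (partial_rep k)) q0 mcoeff0.
Qed.

Lemma mpolyX_neq0 (u : 'X_{1..n}) : 'X_[u] != 0 :> S.
Proof. by rewrite -msupp_eq0 msuppX. Qed.

(** The last step is witnessed by [x^b], which is nonconstant; the others by a binomial [x^u - x^v]
    coming from a link between the next nonrepresentative [a] and [rep a]. *)
Lemma chain_ideal_strict k : (k <= size nonreps)%N ->
  exists2 q, q \in chain_ideal k.+1 & q \notin chain_ideal k.
Proof.
rewrite leq_eqVlt /chain_ideal => /orP[/eqP->|lt_k].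
  exists (\pi_Q (rees_term 1 'X_[b])); rewrite ?leqnn ?ltnn ?inE fiber_form_pi.
    rewrite (initial_form_term (msums1 Bb)) mcoeffX -mdeg_eq0 (Bdeg Bb).
    by rewrite gtn_eqF // base_degree_gt0.
  by rewrite (initial_form_term (msums1 Bb)) mpushX mpolyX_neq0.
pose a := nth i0 nonreps k.
have a_nonrep : rep a != a.
  by have := mem_nth i0 lt_k; rewrite mem_filter => /andP[].
have /asboolP[r [u [v [ru rv uv]]]] := linked_rep B a.
have form_uv : fiber_form (\pi_Q (rees_term r 'X_[u] - rees_term r 'X_[v])) =
    'X_[u] - 'X_[v].
  apply: etrans (fiber_form_pi _) _; apply: etrans (rmorphB initial_form _ _) _.
  by congr (_ - _); [apply: initial_form_term ru | apply: initial_form_term rv].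
exists (\pi_Q (rees_term r 'X_[u] - rees_term r 'X_[v])).
  rewrite lt_k inE form_uv rmorphB /= !mpushX subr_eq0; apply/eqP; congr 'X_[_].
  apply: (@addIm _ U_(rep a)%MM).
  have := congr1 (mnm_push (partial_rep k.+1)) uv.
  rewrite !mnm_pushD !mnm_push1 partial_rep_rep /partial_rep.
  by rewrite (take_nth i0) // mem_rcons mem_head.
rewrite (ltnW lt_k) inE form_uv rmorphB /= !mpushX subr_eq0.
(* At stage [k] the index [a] is not yet moved; equal images of [u] and [v] would cancel from the
   link equation and leave [a = rep a]. *)
apply: contra a_nonrep => /eqP/(congr1 (mcoeff (mnm_push (partial_rep k) u))).
rewrite !mcoeffX eqxx; case: eqP => [E _|_ /eqP]; last by rewrite oner_eq0.
have := congr1 (mnm_push (partial_rep k)) uv.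
rewrite !mnm_pushD !mnm_push1 partial_rep_rep -E => /addmI/mnmP/(_ a).
rewrite !mnm1E /partial_rep in_take ?index_uniq ?mem_nth ?nonreps_uniq //.
by rewrite ltnn eqxx; case: eqP.
Qed.

Lemma fiber_ring_chain :
  exists p : 'I_(#|free_index B i0|).+1 -> {pred Q}, prime_chain p.
Proof.
exists (fun i => chain_ideal i).
split=> [i|i j lt_ij]; first exact: chain_ideal_prime.
split; first exact/chain_ideal_sub/ltnW.
have [|q qS qi] := @chain_ideal_strict i.
  by rewrite -ltnS -card_free_indexE (leq_trans lt_ij) // -ltnS.
by exists q; [exact: (chain_ideal_sub lt_ij qS) | exact: qi].
Qed.

Lemma fiber_form_inj : injective fiber_form.
Proof.
apply: raddf_inj => q /eqP; rewrite -[_ == 0]rees_irrelevant_initial => q0.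
rewrite -[q]reprK -(rmorph0 \pi_Q); apply/eqP.
by rewrite -Quotient.idealrBE subr0.
Qed.

Lemma fiber_form_const c : fiber_form (\pi_Q (rees_term 0 c%:MP)) = c%:MP.
Proof.
apply: etrans (fiber_form_pi _) _; rewrite /initial_form.
suff -> : initial_poly (rees_term 0 c%:MP) = c%:MP%:P by rewrite hornerC.
have cP : c%:MP \in monomial_ideal (msums B 0).
  by rewrite -[c%:MP]mulr1 mem_mull // -mpolyX0 mem_monomial_idealX.
apply/polyP => k.
rewrite coef_initial_poly (val_rees_term cP) expr0 mulr1 !coefC.
case: eqP => [->|_]; last by rewrite raddf0.
apply/mpolyP => m; rewrite mul0n mcoeff_pihomog mcoeffC mdeg_eq0.
by case: eqP => //; rewrite mulr0.
Qed.

(** * The upper bound on chains of primes, by counting monomials *)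

Definition sums_upto D (g : S) :=
  forall m, m \in msupp g -> exists2 k, (k <= D)%N & msums B k m.

Lemma sums_upto1 D : sums_upto D 1.
Proof. by move=> m; rewrite msupp1 inE => /eqP->; exists 0%N. Qed.

Lemma sums_uptoM D E (g h : S) : sums_upto D g -> sums_upto E h ->
  sums_upto (D + E) (g * h).
Proof.
move=> gD hE m /msuppM_le/allpairsP[[u v] /= [/gD[k le_k ku]]].
move=> /hE[l le_l lv] ->.
by exists (k + l)%N; [apply: leq_add | apply: msumsD].
Qed.

Lemma sums_uptoX D N a (g : S) : (a <= N)%N -> sums_upto D g ->
  sums_upto (N * D) (g ^+ a).
Proof.
elim: a N => [|a IHa] [|N] // le_aN gD; rewrite ?expr0; try exact: sums_upto1.
by rewrite exprS mulSn; apply: sums_uptoM => //; apply: IHa.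
Qed.

Lemma sums_upto_monomial D N (y : seq S) e :
  (forall g : S, g \in y -> sums_upto D g) -> e \in exponents (size y) N ->
  sums_upto (size y * (N * D)) (monomial_value y e).
Proof.
elim: y e => [|g y IHy] e gD /=; first by move=> _; apply: sums_upto1.
move=> /allpairsP[[a e'] /= [aN ey ->]]; rewrite mulSn; apply: sums_uptoM.
  apply: sums_uptoX; last by apply: gD; rewrite mem_head.
  by move: aN; rewrite mem_iota add0n => /andP[_ /ltnW].
by apply: IHy => // h hy; apply: gD; rewrite in_cons hy orbT.
Qed.

(** Restriction to the free indices is injective on sums of bases, and each such coordinate takes at
    most [E.+1] values. *)
Lemma msums_count E : exists2 W : seq 'X_{1..n},
  (size W <= E.+1 ^ #|free_index B i0|)%N &
  forall k m, msums B k m -> (forall i, (m i <= E)%N) -> m \in W.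
Proof.
pose mnm (w : {ffun 'I_n -> 'I_E.+1}) := [multinom (w i : nat) | i < n].
pose W := [set w | `[< exists k, msums B k (mnm w) >]].
exists (map mnm (enum W)); last first.
  move=> k m km mE; have <- : mnm [ffun i => inord (m i)] = m.
    by apply/mnmP => i; rewrite mnmE ffunE inordK // ltnS.
  apply: map_f; rewrite mem_enum inE; apply/asboolP; exists k.
  rewrite [mnm _](_ : _ = m) //; apply/mnmP => i.
  by rewrite mnmE ffunE inordK // ltnS.
pose restrict (w : {ffun 'I_n -> 'I_E.+1}) :=
  [ffun i : {i | free_index B i0 i} => w (val i)].
rewrite size_map -cardE -(card_in_imset (f := restrict)).
  rewrite (leq_trans (max_card _)) // card_ffun card_ord card_sig.
  by rewrite (eq_card (B := free_index B i0)).
move=> w w'; rewrite !inE => /asboolP[k kw] /asboolP[k' kw'] /ffunP ww'.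
have /mnmP eq_w : mnm w = mnm w'.
  apply: (msums_determined Bexchange Bdeg Bb b_i0 kw kw') => i i_free.
  by have := ww' (Sub i i_free); rewrite !ffunE !mnmE /= => ->.
by apply/ffunP => i; apply: val_inj; have := eq_w i; rewrite !mnmE.
Qed.

Lemma fiber_form_upto (q : Q) :
  sums_upto (size (rees_val (repr q))) (fiber_form q).
Proof. by move=> m /initial_form_msupp[k /ltnW ? ?]; exists k. Qed.

Lemma fiber_ring_dependent (x : seq Q) : size x = #|free_index B i0|.+1 ->
  exists N (c : seq nat -> K),
    (exists2 e, e \in exponents (size x) N & c e != 0) /\
    \sum_(e <- exponents (size x) N)
      \pi_Q (rees_term 0 (c e)%:MP) * monomial_value x e = 0.
Proof.
set l := #|_| => size_x.
have l_gt0 : (0 < l)%N by rewrite /l card_free_indexE.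
pose D := (\max_(q <- x) size (rees_val (repr q)))%N.
(* All monomials that occur have coordinates at most [E], and [E < N * G]. So there are at most
   [(N * G) ^ l] of them, fewer than the [N ^ l.+1] exponent vectors, as [G ^ l < N]. *)
pose G := (l.+1 * D * d).+1; pose N := (G ^ l).+1.
pose E := (l.+1 * (N * D) * d)%N.
have [W sizeW WP] := msums_count E.
pose y := map fiber_form x.
have yD (g : S) : g \in y -> sums_upto D g.
  move=> /mapP[q qx ->] m /fiber_form_upto[k le_k km]; exists k => //.
  exact: leq_trans le_k (leq_bigmax_seq _ qx _).
have [||e eL m|c [cn0 c0]] := @mpoly_linear_dependence K n _ (exponents l.+1 N)
    (monomial_value y) W.
- exact: exponents_uniq.
- rewrite size_exponents (leq_ltn_trans sizeW) //.
  have leEN : (E.+1 <= N * G)%N by rewrite /E /G mulnS; nia.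
  apply: (@leq_ltn_trans ((N * G) ^ l)); first by rewrite leq_exp2r.
  by rewrite expnMn expnSr ltn_mul2l expn_gt0 /=.
- have sy : size y = l.+1 by rewrite size_map.
  move=> em; have := @sums_upto_monomial D N y e yD; rewrite sy => /(_ eL m em).
  move=> [k le_k km].
  apply: (WP _ _ km) => i; apply: (@leq_trans (mdeg m)).
    by rewrite mdegE (bigD1 i) //= leq_addr.
  by rewrite (mdeg_msums Bdeg km) leq_mul2r le_k orbT.
exists N, c; rewrite size_x; split=> //; apply: fiber_form_inj.
rewrite rmorph0 -[RHS]c0 rmorph_sum; apply: eq_bigr => e _.
rewrite rmorphM /= fiber_form_const mul_mpolyC; congr (_ *: _).
exact: rmorph_monomial_value.
Qed.

Lemma fiber_ring_dim_le e (p : 'I_e.+1 -> {pred Q}) :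
  prime_chain p -> (e <= #|free_index B i0|)%N.
Proof.
move=> [pP pS]; rewrite leqNgt; apply/negP => lt_e; set l := #|_| in lt_e.
(* One element is chosen in each gap of the chain; an algebraic relation among the first [l.+1] of
   them contradicts their independence. *)
have /choice[x xP] (i : nat) : exists q, (i < e)%N ->
    [/\ {subset p (inord i) <= p (inord i.+1)},
        q \in p (inord i.+1) & q \notin p (inord i)].
  have [lt_i|] := boolP (i < e)%N; last by exists 0.
  have [|sub [q q1 q0]] := pS (inord i) (inord i.+1); last by exists q.
  by rewrite !inordK // ltnS ltnW.
have [|N [c [[e0 e0L c0] cE]]] := @fiber_ring_dependent (mkseq x l.+1).
  exact: size_mkseq.
case/eqP: c0; apply: (prime_chain_independent (p := fun i => p (inord i))
  (kappa := fun a => \pi_Q (rees_term 0 a%:MP)) _ _ _ _ _ e0L).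
- by apply: fiber_form_inj; rewrite fiber_form_const !rmorph0.
- move=> a a0; exists (\pi_Q (rees_term 0 a^-1%:MP)); apply: fiber_form_inj.
  apply: etrans (rmorphM fiber_form _ _) _; rewrite rmorph1.
  apply: etrans (congr2 *%R (fiber_form_const _) (fiber_form_const _)) _.
  by rewrite -mpolyCM mulVf.
- by move=> i _; apply: pP.
- rewrite size_mkseq => i lt_i; rewrite nth_mkseq //; apply: xP.
  exact: leq_trans lt_i lt_e.
- by rewrite cE; have [[]] := pP (inord 0).
Qed.

Lemma fiber_ring_krull_dim : is_analytic_spread I #|free_index B i0|.
Proof. by split; [exact: fiber_ring_chain | exact: fiber_ring_dim_le]. Qed.

End FiberRing.

(** The limit is stated as equality for all large [k]; the bound [l <= n] makes the natural-number
    subtraction [n - l] the true difference. *)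
Theorem corollary2p5 (K : fieldType) (n : nat)
    (I : ideal {mpoly K[n]}) :
  polymatroidal_ideal I ->
  ~ (forall f : {mpoly K[n]}, f \in I) ->
  exists l : nat,
    [/\ is_analytic_spread I l,
        (l <= n)%N
      & exists k0 : nat, forall k : nat, (k0 <= k)%N ->
          is_depth {ideal_quot (ideal_exp I k)} (@irrelevant_ideal K n) (n - l)%N].
Proof.
move=> [P Ppoly [IB _]] I_proper.
have [d [[b Bb] Bdeg BX]] := polymatroid_bases Ppoly.
(* If the base [b] were 0, then 1 would be a generator and [I] would not be proper. *)
have [i0 b_i0] : exists i, (0 < b i)%N.
  apply: contrapT => b0; apply: I_proper => f; rewrite -[f]mulr1 mem_mull //.
  rewrite IB -mpolyX0; apply: mem_monomial_idealX.
  suff <- : b = 0%MM by [].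
  apply/mnmP => i; rewrite mnm0E; apply/eqP; rewrite -leqn0 leqNgt.
  by apply/negP => b_i; apply: b0; exists i.
have cardE := card_free_index (polymatroid_base P) i0.
exists #|free_index (polymatroid_base P) i0|; split.
- exact: (fiber_ring_krull_dim BX Bdeg Bb b_i0 IB).
- by rewrite -[X in (_ <= X)%N]cardE leq_addr.
- have [k0 k0P] := polymatroidal_depth BX Bdeg Bb b_i0 IB.
  exists k0 => k /k0P; suff -> : (n - #|free_index (polymatroid_base P) i0|)%N =
      size (other_reps (polymatroid_base P) i0) by [].
  by move: cardE; lia.
Qed.
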